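(* Let $w\in\mathbb R^n$ be an $L$-generic direction, $\Lambda\in\mathfrak L_\beta$, and fix a reference vector $\lambda\in\Lambda$. For every $I\in\mathcal M_w(\Lambda)$, the family $\varepsilon_{\Lambda,I}$ (with $I$-component $1$ and all other components $0$) belongs to $\mathrm{Coeff}^{\mathrm{dir}}_w(\Lambda)$, and the series $\varphi^{(\lambda)}_{\Lambda,I}$ obtained from it satisfies $$\varphi^{(\lambda)}_{\Lambda,I}\in\mathrm{Sol}^{\mathrm{dir}}_{w,\Lambda}(H_A(\beta)),\qquad\mathrm{Supp}\bigl(\varphi^{(\lambda)}_{\Lambda,I}\bigr)=\Lambda_I.$$ In particular, $\mathrm{lexp}_w\bigl(\varphi^{(\lambda)}_{\Lambda,I}\bigr)=v_{\Lambda,I}$. Moreover, the following conditions are equivalent: (1) $\mathcal M_w(\Lambda)\ne\emptyset$. (2) $M^{\mathrm{dir}}_{\Lambda,w}\ne0$. (3) $\mathrm{Coeff}^{\mathrm{dir}}_w(\Lambda)\ne0$. (4) $\mathrm{Sol}^{\mathrm{dir}}_{w,\Lambda}(H_A(\beta))\ne0$.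
   Context: Basics. $\mathbb N=\{0,1,2,\dots\}$, $[n]=\{1,\dots,n\}$. $A=(a_{ij})\in\mathrm{Mat}_{d\times n}(\mathbb Z)$ has rank $d$, $\beta\in\mathbb C^d$, $L=\mathrm{Ker}_{\mathbb Z}(A)$. An exponent lattice is a coset $\Lambda=\lambda+L$ with $\lambda\in\mathbb C^n$, $A\lambda=\beta$; $\mathfrak L_\beta$ is the set of all of them. Hypergeometric ideal. $D=\mathbb C\langle x_1,\dots,x_n,\partial_{x_1},\dots,\partial_{x_n}\rangle$ is the Weyl algebra, $\theta_{x_j}=x_j\partial_{x_j}$, $(A\theta_x)_i=\sum_ja_{ij}\theta_{x_j}$. For $u\in\mathbb Z^n$ write $u=u_+-u_-$ with $u_\pm\in\mathbb N^n$ of disjoint support. $I_A=\langle\partial_x^{u_+}-\partial_x^{u_-}\mid u\in L\rangle\subset\mathbb C[\partial_x]$, $H_A(\beta)=DI_A+\sum_{i=1}^dD((A\theta_x)_i-\beta_i)$. Formal series. $S=\mathbb C[\partial_{y_1},\dots,\partial_{y_n}]$ acts on $\mathbb C[y]$ by differentiation, written $\bullet$; $(A\partial_y)_i=\sum_ja_{ij}\partial_{y_j}$; $\partial_y^K=\prod_{j\in K}\partial_{y_j}$. $\widetilde\Lambda=\Lambda+\mathbb Z^n$. $\mathscr F^{\log}_{\widetilde\Lambda}$ is the space of all formal (possibly infinite) sums $\sum_{\gamma\in\widetilde\Lambda}x^\gamma p_\gamma(\log x)$, $p_\gamma\in\mathbb C[y]$, with coefficientwise equality, on which $D$ acts coefficientwise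 by $x_j\bullet(x^\gamma p(\log x))=x^{\gamma+e_j}p(\log x)$, $\partial_{x_j}\bullet(x^\gamma p(\log x))=x^{\gamma-e_j}((\gamma_j+\partial_{y_j})\bullet p)(\log x)$. $\mathrm{Supp}(\varphi)=\{\gamma\mid p_\gamma\ne0\}$. Supports and direction. $\mathrm{nsupp}(\gamma)=\{j\in[n]\mid\gamma_j\in\mathbb Z_{<0}\}$; $\Lambda_I=\{\gamma\in\Lambda\mid\mathrm{nsupp}(\gamma)=I\}$; $\mathrm{NS}(\Lambda)=\{I\mid\Lambda_I\ne\emptyset\}$; $\mathrm{MinNS}(\Lambda)$ is the set of inclusion-minimal elements of $\mathrm{NS}(\Lambda)$. $w$ is $L$-generic if $w\cdot u\ne0$ for all $u\in L\setminus\{0\}$. On $\Lambda$, $\gamma\le_w\gamma'$ iff $w\cdot(\gamma'-\gamma)\ge0$ (a total order). $\mathcal B_w(\Lambda)$ is the set of $I\in\mathrm{NS}(\Lambda)$ such that $\{w\cdot(\gamma-\lambda)\mid\gamma\in\Lambda_I\}$ is bounded below in $\mathbb R$ (for one, equivalently any, $\lambda\in\Lambda$); for $I\in\mathcal B_w(\Lambda)$, $v_{\Lambda,I}$ is the (existing, unique) $\le_w$-minimum of $\Lambda_I$. $\mathcal M_w(\Lambda)=\mathrm{MinNS}(\Lambda)\cap\mathcal B_w(\Lambda)$. $\mathcal A_w(\Lambda)$ is the set of $I\in\mathrm{NS}(\Lambda)$ such that every $J\in\mathrm{NS}(\Lambda)$ with $J\subset I$ lies in $\mathcal B_w(\Lambda)$.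 Solutions. $\mathrm{Sol}^{\mathrm{dir}}_{w,\Lambda}(H_A(\beta))$ is the set of $\varphi\in\mathscr F^{\log}_{\widetilde\Lambda}$ with $\mathrm{Supp}(\varphi)\subset\Lambda$ and $H_A(\beta)\bullet\varphi=0$ such that $\varphi=0$ or $\mathrm{Supp}(\varphi)$ has a $\le_w$-minimum; for $\varphi\ne0$ this minimum is $\mathrm{lexp}_w(\varphi)$. Transit operators. For $\alpha\in\mathbb C^n$, $\nu\in\mathbb N^n$: $[\partial_y+\alpha]_\nu=\prod_{j=1}^n\prod_{k=0}^{\nu_j-1}(\partial_{y_j}+\alpha_j-k)$. For $\gamma,\gamma'\in\Lambda$: $d_{\gamma'\leftarrow\gamma}=[\partial_y+\gamma]_{(\gamma-\gamma')_+}\in S$, which is divisible in $S$ by $\partial_y^{\mathrm{nsupp}(\gamma')\setminus\mathrm{nsupp}(\gamma)}$, and $\widetilde d_{\gamma'\leftarrow\gamma}=d_{\gamma'\leftarrow\gamma}/\partial_y^{\mathrm{nsupp}(\gamma')\setminus\mathrm{nsupp}(\gamma)}$, which acts bijectively on $\mathbb C[y]$. Coefficient space and module. $\mathrm{Coeff}^{\mathrm{dir}}_w(\Lambda)$ is the space of families $(c_{\Lambda,I})_{I\in\mathrm{NS}(\Lambda)}$ in $\mathbb C[y]$ with $(A\partial_y)_i\bullet c_{\Lambda,I}=0$ for all $I,i$; $\partial_y^{J\setminus I}\bullet c_{\Lambda,I}=\partial_y^{I\setminus J}\bullet c_{\Lambda,J}$ for all $I,J\in\mathrm{NS}(\Lambda)$;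 and $c_{\Lambda,I}=0$ for $I\in\mathrm{NS}(\Lambda)\setminus\mathcal A_w(\Lambda)$. $M^{\mathrm{dir}}_{\Lambda,w}$ is the quotient of the free $S$-module $\bigoplus_{I\in\mathrm{NS}(\Lambda)}Se^*_{\Lambda,I}$ by the submodule generated by all $(A\partial_y)_ie^*_{\Lambda,I}$, all $\partial_y^{J\setminus I}e^*_{\Lambda,I}-\partial_y^{I\setminus J}e^*_{\Lambda,J}$, and all $e^*_{\Lambda,K}$ with $K\in\mathrm{NS}(\Lambda)\setminus\mathcal A_w(\Lambda)$. The special family and series. For $I\in\mathcal M_w(\Lambda)$, $\varepsilon_{\Lambda,I}\in\prod_{K\in\mathrm{NS}(\Lambda)}\mathbb C[y]$ has $(\varepsilon_{\Lambda,I})_I=1$ and $(\varepsilon_{\Lambda,I})_K=0$ for $K\ne I$. The series is $\varphi^{(\lambda)}_{\Lambda,I}=\sum_{\gamma\in\Lambda}x^\gamma r_\gamma(\log x)$ with $r_\gamma=(\widetilde d_{\lambda\leftarrow\gamma}\bullet)^{-1}\bigl(\widetilde d_{\gamma\leftarrow\lambda}\bullet(\varepsilon_{\Lambda,I})_{\mathrm{nsupp}(\gamma)}\bigr)$. *)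

(* Defs.v *)
From HB Require Import structures.
From mathcomp Require Import all_boot all_order all_algebra.
From mathcomp Require Import boolp classical_sets functions reals.
From mathcomp Require Import complex generic_quotient ring_quotient.
From mathcomp Require finmap monalg mpoly.

Set Implicit Arguments.
Unset Strict Implicit.
Unset Printing Implicit Defensive.

Import Order.TTheory GRing.Theory Num.Theory.

Local Open Scope ring_scope.
Local Open Scope quotient_scope.
Local Open Scope classical_set_scope.

Section LinearSpan.
Variables (S : pzRingType) (V : lmodType S).

(* Taking V := S^o yields the left ideal of S generated by G. *)
Definition lin_span (G : set V) : set V :=
  [set v | exists k (a : 'I_k -> S) (g : 'I_k -> V),
     (forall i, G (g i)) /\ v = \sum_i a i *: g i].

Variable G : set V.

Lemma lin_span0 : lin_span G 0.
Proof.
exists 0%N, (fun=> 0), (fun=> 0); split; first by case.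
by rewrite big_ord0.
Qed.

Lemma lin_spanD u v : lin_span G u -> lin_span G v -> lin_span G (u + v).
Proof.
move=> [k [a [g [Gg ->]]]] [l [b [h [Gh ->]]]].
exists (k + l)%N, (fun i : 'I_(k + l) => match fintype.split i with inl j => a j | inr j => b j end),
  (fun i : 'I_(k + l) => match fintype.split i with inl j => g j | inr j => h j end).
split=> [i|]; first by case: (fintype.split i).
rewrite big_split_ord /=; congr (_ + _); apply: eq_bigr => i _.
  by rewrite (unsplitK (inl i)).
by rewrite (unsplitK (inr i)).
Qed.

Lemma lin_spanZ c v : lin_span G v -> lin_span G (c *: v).
Proof.
move=> [k [a [g [Gg ->]]]]; exists k, (fun i => c * a i), g; split=> //.
by rewrite scaler_sumr; apply: eq_bigr => i _; rewrite scalerA.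
Qed.

Definition span_pred : {pred V} := fun v => `[< lin_span G v >].

Lemma span_pred_zmod_closed : zmod_closed span_pred.
Proof.
split=> [|u v /asboolP Hu /asboolP Hv]; apply/asboolP; first exact: lin_span0.
by rewrite -[- v]scaleN1r; apply/lin_spanD/lin_spanZ.
Qed.
HB.instance Definition _ := GRing.isZmodClosed.Build V span_pred
  span_pred_zmod_closed.

Definition quot_mod := Quotient.quot span_pred.
HB.instance Definition _ := GRing.Zmodule.on quot_mod.

Definition quot_mod_pi (v : V) : quot_mod := \pi_(Quotient.quot span_pred) v.

Lemma quot_mod_piP u v :
  reflect (quot_mod_pi u = quot_mod_pi v) (u - v \in span_pred).
Proof. by rewrite Quotient.idealrBE; apply: eqP. Qed.

Lemma quot_mod_repr (x : quot_mod) : quot_mod_pi (repr x) = x.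
Proof. exact: reprK. Qed.

Lemma quot_mod_piD u v : quot_mod_pi (u + v) = quot_mod_pi u + quot_mod_pi v.
Proof. exact: raddfD. Qed.

Definition quot_scale (c : S) (x : quot_mod) : quot_mod :=
  quot_mod_pi (c *: repr x).

Lemma quot_scaleE c v : quot_scale c (quot_mod_pi v) = quot_mod_pi (c *: v).
Proof.
apply/quot_mod_piP; rewrite -scalerBr; apply/asboolP/lin_spanZ/asboolP.
by apply/quot_mod_piP; rewrite quot_mod_repr.
Qed.

Fact quot_scaleA a b x : quot_scale a (quot_scale b x) = quot_scale (a * b) x.
Proof. by rewrite -[x]quot_mod_repr !quot_scaleE scalerA. Qed.
Fact quot_scale1 : left_id 1 quot_scale.
Proof. by move=> x; rewrite -[x]quot_mod_repr quot_scaleE scale1r. Qed.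
Fact quot_scaleDr : right_distributive quot_scale +%R.
Proof.
move=> a x y; rewrite -[x]quot_mod_repr -[y]quot_mod_repr.
by rewrite -quot_mod_piD !quot_scaleE scalerDr quot_mod_piD.
Qed.
Fact quot_scaleDl x : {morph quot_scale^~ x : a b / a + b}.
Proof. by move=> a b; rewrite -[x]quot_mod_repr !quot_scaleE scalerDl quot_mod_piD. Qed.
HB.instance Definition _ := GRing.Zmodule_isLmodule.Build S quot_mod
  quot_scaleA quot_scale1 quot_scaleDr quot_scaleDl.

End LinearSpan.

Section TwoSidedIdeal.
Variables (T : pzRingType) (G : set T).

Definition ideal_span : set T :=
  [set v | exists k (a g b : 'I_k -> T),
     (forall i, G (g i)) /\ v = \sum_i a i * g i * b i].

Lemma ideal_spanD u v : ideal_span u -> ideal_span v -> ideal_span (u + v).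
Proof.
move=> [k [a [g [a' [Gg ->]]]]] [l [b [h [b' [Gh ->]]]]].
exists (k + l)%N, (fun i : 'I_(k + l) => match fintype.split i with inl j => a j | inr j => b j end),
  (fun i : 'I_(k + l) => match fintype.split i with inl j => g j | inr j => h j end),
  (fun i : 'I_(k + l) => match fintype.split i with inl j => a' j | inr j => b' j end).
split=> [i|]; first by case: (fintype.split i).
rewrite big_split_ord /=; congr (_ + _); apply: eq_bigr => i _.
  by rewrite (unsplitK (inl i)).
by rewrite (unsplitK (inr i)).
Qed.

Lemma ideal_spanMl c v : ideal_span v -> ideal_span (c * v).
Proof.
move=> [k [a [g [b [Gg ->]]]]]; exists k, (fun i => c * a i), g, b; split=> //.
by rewrite mulr_sumr; apply: eq_bigr => i _; rewrite !mulrA.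
Qed.

Lemma ideal_spanMr c v : ideal_span v -> ideal_span (v * c).
Proof.
move=> [k [a [g [b [Gg ->]]]]]; exists k, a, g, (fun i => b i * c); split=> //.
by rewrite mulr_suml; apply: eq_bigr => i _; rewrite !mulrA.
Qed.

Definition ideal_pred : {pred T} := fun v => `[< ideal_span v >].

Lemma ideal_pred_zmod_closed : zmod_closed ideal_pred.
Proof.
split=> [|u v /asboolP Hu /asboolP Hv]; apply/asboolP.
  exists 0%N, (fun=> 0), (fun=> 0), (fun=> 0); split; first by case.
  by rewrite big_ord0.
by rewrite -mulN1r; apply/ideal_spanD/ideal_spanMl.
Qed.
HB.instance Definition _ := GRing.isZmodClosed.Build T ideal_pred
  ideal_pred_zmod_closed.

Definition quot_ring := Quotient.quot ideal_pred.
HB.instance Definition _ := GRing.Zmodule.on quot_ring.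

Definition quot_pi (v : T) : quot_ring := \pi_(Quotient.quot ideal_pred) v.

Lemma quot_piP u v : reflect (quot_pi u = quot_pi v) (u - v \in ideal_pred).
Proof. by rewrite Quotient.idealrBE; apply: eqP. Qed.

Lemma quot_repr (x : quot_ring) : quot_pi (repr x) = x.
Proof. exact: reprK. Qed.

Lemma quot_piB u v : quot_pi (u - v) = quot_pi u - quot_pi v.
Proof. exact: raddfB. Qed.
Lemma quot_piD u v : quot_pi (u + v) = quot_pi u + quot_pi v.
Proof. exact: raddfD. Qed.

Definition quot_mul (x y : quot_ring) : quot_ring := quot_pi (repr x * repr y).

Lemma quot_mulE u v : quot_mul (quot_pi u) (quot_pi v) = quot_pi (u * v).
Proof.
apply/quot_piP/asboolP; set u' := repr _; set v' := repr _.
have Hu : ideal_span (u' - u) by apply/asboolP/quot_piP; rewrite quot_repr.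
have Hv : ideal_span (v' - v) by apply/asboolP/quot_piP; rewrite quot_repr.
rewrite -[u' * v'](addrNK (u' * v)) -mulrBr -addrA -mulrBl.
by apply: ideal_spanD; [apply: ideal_spanMl|apply: ideal_spanMr].
Qed.

Fact quot_mulA : associative quot_mul.
Proof.
move=> x y z; rewrite -[x]quot_repr -[y]quot_repr -[z]quot_repr.
by rewrite !quot_mulE mulrA.
Qed.
Fact quot_mul1l : left_id (quot_pi 1) quot_mul.
Proof. by move=> x; rewrite -[x]quot_repr quot_mulE mul1r. Qed.
Fact quot_mul1r : right_id (quot_pi 1) quot_mul.
Proof. by move=> x; rewrite -[x]quot_repr quot_mulE mulr1. Qed.
Fact quot_mulDl : left_distributive quot_mul +%R.
Proof.
move=> x y z; rewrite -[x]quot_repr -[y]quot_repr -[z]quot_repr.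
by rewrite -quot_piD !quot_mulE mulrDl quot_piD.
Qed.
Fact quot_mulDr : right_distributive quot_mul +%R.
Proof.
move=> x y z; rewrite -[x]quot_repr -[y]quot_repr -[z]quot_repr.
by rewrite -quot_piD !quot_mulE mulrDr quot_piD.
Qed.
HB.instance Definition _ := GRing.Zmodule_isPzRing.Build quot_ring
  quot_mulA quot_mul1l quot_mul1r quot_mulDl quot_mulDr.

Lemma quot_piM u v : quot_pi (u * v) = quot_pi u * quot_pi v.
Proof. by rewrite -quot_mulE. Qed.
Lemma quot_pi1 : quot_pi 1 = 1.
Proof. by []. Qed.

End TwoSidedIdeal.

Section WeylAlgebra.
Import finmap monalg.
Variables (K : comNzRingType) (n : nat).

Local Notation T := {malg K[{fmonom ('I_n + 'I_n)%type}]}.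

(* Letters: inl j stands for x_j and inr j for d/dx_j. *)
Definition free_var (g : 'I_n + 'I_n) : T := << fmu g >>%R.

Inductive weyl_rel : set T :=
| weyl_rel_xx j k :
    weyl_rel (free_var (inl j) * free_var (inl k)
              - free_var (inl k) * free_var (inl j))
| weyl_rel_dd j k :
    weyl_rel (free_var (inr j) * free_var (inr k)
              - free_var (inr k) * free_var (inr j))
| weyl_rel_dx j k :
    weyl_rel (free_var (inr j) * free_var (inl k)
              - free_var (inl k) * free_var (inr j) - (j == k)%:R).

Definition weyl : Type := quot_ring weyl_rel.
HB.instance Definition _ := GRing.PzRing.on weyl.

Definition weyl_pi (P : T) : weyl := quot_pi weyl_rel P.
Definition weylC (c : K) : weyl := weyl_pi c%:MP.
Definition weylX (j : 'I_n) : weyl := weyl_pi (free_var (inl j)).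
Definition weylD (j : 'I_n) : weyl := weyl_pi (free_var (inr j)).

Section Action.
Variables (V : lmodType K) (X D : 'I_n -> {linear V -> V}).

Definition letter_act (g : 'I_n + 'I_n) : V -> V :=
  match g with inl j => X j | inr j => D j end.

Definition free_act (P : T) (v : V) : V :=
  \sum_(m <- msupp P) P@_m *: foldr letter_act v (m : seq _).

(* The choice of representative is immaterial as soon as X and D satisfy the
   Weyl relations: see weyl_act_pi. *)
Definition weyl_act (P : weyl) (v : V) : V :=
  free_act (repr (P : quot_ring weyl_rel)) v.

Let word_act (m : {fmonom ('I_n + 'I_n)%type}) v :=
  foldr letter_act v (m : seq _).

Let word_actP m a u v : word_act m (a *: u + v) = a *: word_act m u + word_act m v.
Proof.
rewrite /word_act; elim: (m : seq _) => //= g s ->.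
by case: g => j /=; rewrite linearP.
Qed.

Lemma free_actEw (d : {fset {fmonom ('I_n + 'I_n)%type}}) P v :
  (msupp P `<=` d)%fset -> free_act P v = \sum_(m <- d) P@_m *: word_act m v.
Proof.
move=> le; rewrite /free_act (big_fset_incl _ le) => //= m _ /mcoeff_outdom ->.
by rewrite scale0r.
Qed.

Lemma free_actU c m v : free_act << c *g m >> v = c *: word_act m v.
Proof. by rewrite (free_actEw _ msuppU_le) big_seq_fset1 mcoeffUU. Qed.

Lemma free_actB P Q v : free_act (P - Q) v = free_act P v - free_act Q v.
Proof.
have le1 : (msupp P `<=` msupp P `|` msupp Q)%fset by exact: fsubsetUl.
have le2 : (msupp Q `<=` msupp P `|` msupp Q)%fset by exact: fsubsetUr.
rewrite (free_actEw _ le1) (free_actEw _ le2) (free_actEw _ (msuppB_le _ _)).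
by rewrite -sumrB; apply: eq_bigr => m _; rewrite mcoeffB scalerBl.
Qed.

Lemma free_act0 v : free_act 0 v = 0.
Proof. by rewrite -(subrr 0) free_actB subrr. Qed.

Lemma free_actD P Q v : free_act (P + Q) v = free_act P v + free_act Q v.
Proof.
by rewrite -[Q in LHS]opprK free_actB -[- Q]sub0r free_actB free_act0 sub0r opprK.
Qed.

Lemma free_act_sum I r (F : I -> T) v :
  free_act (\sum_(i <- r) F i) v = \sum_(i <- r) free_act (F i) v.
Proof.
by apply: (big_morph (free_act^~ v)) => [P Q|]; rewrite ?free_actD ?free_act0.
Qed.

Lemma free_actP P a u v : free_act P (a *: u + v) = a *: free_act P u + free_act P v.
Proof.
rewrite /free_act scaler_sumr -big_split /=; apply: eq_bigr => m _.
by rewrite -/(word_act _ _) word_actP scalerDr !scalerA mulrC.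
Qed.

Lemma free_act_v0 P : free_act P 0 = 0.
Proof. by have := free_actP P (-1) 0 0; rewrite !scaleN1r oppr0 addr0 addNr. Qed.

Lemma free_actM P Q v : free_act (P * Q) v = free_act P (free_act Q v).
Proof.
rewrite malgME free_act_sum {2}/free_act; apply: eq_bigr => m _.
rewrite free_act_sum /free_act -/(word_act m _).
have -> : word_act m (\sum_(m0 <- msupp Q) Q@_m0 *: word_act m0 v) =
    \sum_(m0 <- msupp Q) Q@_m0 *: word_act m (word_act m0 v).
  elim: (msupp Q : seq _) => [|k s IH]; last by rewrite !big_cons word_actP IH.
  rewrite !big_nil; have := word_actP m (-1) 0 0.
  by rewrite !scaleN1r oppr0 addr0 addNr.
rewrite scaler_sumr; apply: eq_bigr => k _.
by rewrite -/(free_act _ _) free_actU scalerA /word_act fmM foldr_cat.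
Qed.

Lemma free_act_var g v : free_act (free_var g) v = letter_act g v.
Proof. by rewrite free_actU scale1r /word_act fmU. Qed.

Lemma free_actC c v : free_act c%:MP v = c *: v.
Proof. by rewrite free_actU /word_act fm1. Qed.

Lemma free_act1 v : free_act 1 v = v.
Proof. by rewrite -[1]/(1%:MP) free_actC scale1r. Qed.

Hypothesis XX : forall j k v, X j (X k v) = X k (X j v).
Hypothesis DD : forall j k v, D j (D k v) = D k (D j v).
Hypothesis DX : forall j k v, D j (X k v) = X k (D j v) + (j == k)%:R *: v.

Lemma free_act_varM g h v :
  free_act (free_var g * free_var h) v = letter_act g (letter_act h v).
Proof. by rewrite free_actM (free_act_var h) (free_act_var g). Qed.

Lemma free_act_commutator g h v :
  free_act (free_var g * free_var h - free_var h * free_var g) v =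
  letter_act g (letter_act h v) - letter_act h (letter_act g v).
Proof.
exact: etrans (free_actB _ _ _)
  (congr2 (fun a b : V => a - b) (free_act_varM g h v) (free_act_varM h g v)).
Qed.

Lemma free_act_rel P v : weyl_rel P -> free_act P v = 0.
Proof.
case=> j k.
- by apply: etrans (free_act_commutator _ _ _) _; rewrite /= XX subrr.
- by apply: etrans (free_act_commutator _ _ _) _; rewrite /= DD subrr.
apply: etrans (free_actB _ _ _) _; apply/eqP; rewrite subr_eq0; apply/eqP.
apply: etrans (free_act_commutator _ _ _) _.
rewrite /= DX [_ + _ *: _]addrC addrK.
by case: (j == k); rewrite ?free_act1 ?scale1r ?free_act0 ?scale0r.
Qed.

Lemma free_act_ideal P v : ideal_span weyl_rel P -> free_act P v = 0.
Proof.
move=> [k [a [g [b [Gg ->]]]]]; rewrite free_act_sum big1 // => i _.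
by rewrite 2!free_actM (free_act_rel _ (Gg i)) free_act_v0.
Qed.

Lemma weyl_act_pi P v : weyl_act (weyl_pi P) v = free_act P v.
Proof.
apply/eqP; rewrite -subr_eq0 -free_actB; apply/eqP/free_act_ideal/asboolP.
by apply/quot_piP; rewrite quot_repr.
Qed.

Lemma weyl_actD P Q v : weyl_act (P + Q) v = weyl_act P v + weyl_act Q v.
Proof.
by rewrite -[P]quot_repr -[Q]quot_repr -quot_piD !weyl_act_pi free_actD.
Qed.

Lemma weyl_actM P Q v : weyl_act (P * Q) v = weyl_act P (weyl_act Q v).
Proof.
by rewrite -[P]quot_repr -[Q]quot_repr -quot_piM !weyl_act_pi free_actM.
Qed.

Lemma weyl_act1 v : weyl_act 1 v = v.
Proof. by rewrite -[1]/(weyl_pi 1) weyl_act_pi free_act1. Qed.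

Lemma weyl_act0 v : weyl_act 0 v = 0.
Proof. by have := weyl_actD 0 0 v; rewrite addr0 -[LHS]addr0 => /addrI. Qed.

Lemma weyl_actC c v : weyl_act (weylC c) v = c *: v.
Proof. by rewrite weyl_act_pi free_actC. Qed.

Lemma weyl_actX j v : weyl_act (weylX j) v = X j v.
Proof. by rewrite weyl_act_pi free_act_var. Qed.

Lemma weyl_actDer j v : weyl_act (weylD j) v = D j v.
Proof. by rewrite weyl_act_pi free_act_var. Qed.

End Action.
End WeylAlgebra.

Import mpoly.

Section WeylNonzero.
Variables (K : comNzRingType) (n : nat).

Definition mpoly_mulX (j : 'I_n) (p : {mpoly K[n]}) : {mpoly K[n]} := 'X_j * p.
Lemma mpoly_mulX_linear j : linear (mpoly_mulX j).
Proof. by move=> a p q; rewrite /mpoly_mulX mulrDr scalerAr. Qed.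
HB.instance Definition _ j := GRing.isLinear.Build K {mpoly K[n]} {mpoly K[n]} _
  (mpoly_mulX j) (mpoly_mulX_linear j).

(* D acts on polynomials, hence D is not the zero ring. *)
Lemma weyl_oner_neq0 : (1 : weyl K n) != 0.
Proof.
pose act := weyl_act (K := K) (V := {mpoly K[n]})
  (fun j => mpoly_mulX j : {linear _ -> _}) (fun j => mderiv j : {linear _ -> _}).
have XX j k (v : {mpoly K[n]}) :
  mpoly_mulX j (mpoly_mulX k v) = mpoly_mulX k (mpoly_mulX j v).
  by rewrite /mpoly_mulX mulrCA.
have DD j k (v : {mpoly K[n]}) : mderiv j (mderiv k v) = mderiv k (mderiv j v).
  by rewrite mderiv_comm.
have DX j k (v : {mpoly K[n]}) : mderiv j (mpoly_mulX k v) =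
    mpoly_mulX k (mderiv j v) + (j == k)%:R *: v.
  rewrite /mpoly_mulX mderivM mderivX mnmE eq_sym addrC; congr (_ + _).
  case: eqP => [->|_]; last by rewrite mulr0n scale0r mul0r scale0r.
  have -> : (U_(k) - U_(k) = 0)%MM by apply/mnmP => l; rewrite !mnmE subnn.
  by rewrite mpolyX0 mulr1n scale1r mul1r scale1r.
have a1 : act 1 1 = 1 by apply: weyl_act1.
have a0 : act 0 1 = 0 by apply: weyl_act0.
by apply/eqP => e; move: a1; rewrite e a0 => /esym/eqP; rewrite oner_eq0.
Qed.
HB.instance Definition _ :=
  GRing.PzSemiRing_isNonZero.Build (weyl K n) weyl_oner_neq0.
End WeylNonzero.

Section Hypergeometric.
Variables (R : realType) (d n : nat) (A : 'M[int]_(d, n)).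
Local Notation C := R[i].

Definition ker_int : set 'cV[int]_n := [set u | A *m u = 0].

Definition exponent_lattice (beta : 'cV[C]_d) (Lam : set 'cV[C]_n) : Prop :=
  exists lam : 'cV[C]_n, map_mx intr A *m lam = beta /\
    Lam = [set lam + map_mx intr u | u in ker_int].

Definition L_generic (w : 'cV[R]_n) : Prop :=
  forall u, ker_int u -> u != 0 -> \sum_j w j 0 * (u j 0)%:~R != 0.

Definition pos_part (u : 'cV[int]_n) : 'X_{1..n} :=
  [multinom `|(Num.max (u j 0) 0)%R|%N | j < n].

(* The letters of {mpoly C[n]} stand for the partial derivatives d/dx_j. *)
Definition toric_ideal : set {mpoly C[n]} :=
  lin_span (V := {mpoly C[n]}^o)
    [set 'X_[pos_part u] - 'X_[pos_part (- u)] | u in ker_int].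

Definition weyl_of_partial (q : {mpoly C[n]}) : weyl C n :=
  mmap (@weylC C n) (@weylD C n) q.

Definition weyl_euler (i : 'I_d) : weyl C n :=
  \sum_j (A i j)%:~R * (weylX C j * weylD C j).

Definition hyp_ideal (beta : 'cV[C]_d) : set (weyl C n) :=
  lin_span (V := (weyl C n)^o)
    ([set weyl_of_partial q | q in toric_ideal] `|`
     range (fun i => weyl_euler i - weylC n (beta i 0))).

(* A symbol P in {mpoly C[n]} acting as the differential operator P(d/dy). *)
Definition dact (P p : {mpoly C[n]}) : {mpoly C[n]} :=
  \sum_(m <- msupp P) P@_m *: p^`M[m].

Definition partial_prod (J : {set 'I_n}) : {mpoly C[n]} := \prod_(j in J) 'X_j.

Definition Apartial (i : 'I_d) : {mpoly C[n]} := \sum_j (A i j)%:~R *: 'X_j.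

(* phi : logseries represents the formal sum of all x^g (phi g)(log x). *)
Definition logseries : Type := 'cV[C]_n -> {mpoly C[n]}.
HB.instance Definition _ := GRing.Lmodule.on logseries.

Definition unit_vec (j : 'I_n) : 'cV[C]_n := delta_mx j 0.

Lemma unit_vecE j k : unit_vec j k 0 = (k == j)%:R.
Proof. by rewrite !mxE eqxx andbT. Qed.

Definition series_x (j : 'I_n) (phi : logseries) : logseries :=
  fun g => phi (g - unit_vec j).

(* The coefficient at x^g of d/dx_j phi comes from the term x^(g + e_j). *)
Definition series_d (j : 'I_n) (phi : logseries) : logseries :=
  fun g => (g j 0 + 1) *: phi (g + unit_vec j) + (phi (g + unit_vec j))^`M(j).

Lemma series_x_linear j : linear (series_x j).
Proof. by move=> a p q; apply/funext. Qed.
HB.instance Definition _ j :=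
  GRing.isLinear.Build C logseries logseries _ (series_x j) (series_x_linear j).

Lemma series_d_linear j : linear (series_d j).
Proof.
move=> a p q; apply/funext => g; rewrite /series_d.
have fE (x y : logseries) h : (a *: x + y) h = a *: x h + y h by [].
rewrite !fE mderivD mderivZ !scalerDr !scalerA [a * _]mulrC.
by rewrite addrACA.
Qed.
HB.instance Definition _ j :=
  GRing.isLinear.Build C logseries logseries _ (series_d j) (series_d_linear j).

Lemma series_xx j k phi : series_x j (series_x k phi) = series_x k (series_x j phi).
Proof. by apply/funext => g; rewrite /series_x addrAC. Qed.

Lemma series_dd j k phi : series_d j (series_d k phi) = series_d k (series_d j phi).
Proof.
apply/funext => g; have addE (x y : 'cV[C]_n) l : (x + y) l 0 = x l 0 + y l 0 by rewrite mxE.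
have [->//|jk] := eqVneq j k.
rewrite /series_d [g + unit_vec k + _]addrAC !addE !unit_vecE.
rewrite [k == j]eq_sym (negPf jk) !addr0.
rewrite !mderivD !mderivZ !scalerDr !scalerA.
set F := phi _; set a := g j 0 + 1; set b := g k 0 + 1.
rewrite (mulrC a b) (mderiv_comm k j F) addrACA; reflexivity.
Qed.

Lemma series_dx j k phi : series_d j (series_x k phi) =
  series_x k (series_d j phi) + (j == k)%:R *: phi.
Proof.
apply/funext => g; rewrite /series_d /series_x.
have fE (x y : logseries) a h : (x + a *: y) h = x h + a *: y h by [].
have subE (x y : 'cV[C]_n) l : (x - y) l 0 = x l 0 - y l 0 by rewrite !mxE.
rewrite fE [g - _ + _]addrAC subE unit_vecE.
have [->|jk] := eqVneq j k; last by rewrite subr0 scale0r addr0.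
rewrite addrK subrK scalerDl addrAC; reflexivity.
Qed.

Definition series_act : weyl C n -> logseries -> logseries :=
  weyl_act (fun j => series_x j : {linear logseries -> logseries})
           (fun j => series_d j : {linear logseries -> logseries}).

Lemma series_act1 phi : series_act 1 phi = phi.
Proof. by apply: weyl_act1; [apply: series_xx|apply: series_dd|apply: series_dx]. Qed.
Lemma series_actM P Q phi : series_act (P * Q) phi = series_act P (series_act Q phi).
Proof. by apply: weyl_actM; [apply: series_xx|apply: series_dd|apply: series_dx]. Qed.
Lemma series_actD P Q phi : series_act (P + Q) phi = series_act P phi + series_act Q phi.
Proof. by apply: weyl_actD; [apply: series_xx|apply: series_dd|apply: series_dx]. Qed.
Lemma series_actC c phi : series_act (weylC n c) phi = c *: phi.
Proof. by apply: weyl_actC; [apply: series_xx|apply: series_dd|apply: series_dx]. Qed.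
Lemma series_actX j phi : series_act (weylX C j) phi = series_x j phi.
Proof. by apply: weyl_actX; [apply: series_xx|apply: series_dd|apply: series_dx]. Qed.
Lemma series_actDer j phi : series_act (weylD C j) phi = series_d j phi.
Proof. by apply: weyl_actDer; [apply: series_xx|apply: series_dd|apply: series_dx]. Qed.

Definition supp (phi : logseries) : set 'cV[C]_n := [set g | phi g != 0].

Definition lattice_hull (Lam : set 'cV[C]_n) : set 'cV[C]_n :=
  [set g + map_mx intr u | g in Lam & u in [set: 'cV[int]_n]].

Definition Flog (Lam : set 'cV[C]_n) : set logseries :=
  [set phi | supp phi `<=` lattice_hull Lam].

Definition nsupp (g : 'cV[C]_n) : {set 'I_n} :=
  [set j | `[< exists k : nat, g j 0 = - k.+1%:R >]]%SET.

Definition stratum (Lam : set 'cV[C]_n) (I : {set 'I_n}) : set 'cV[C]_n :=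
  [set g | Lam g /\ nsupp g = I].

Definition NS (Lam : set 'cV[C]_n) : {set {set 'I_n}} :=
  [set I | `[< stratum Lam I !=set0 >]]%SET.

Definition MinNS (Lam : set 'cV[C]_n) : {set {set 'I_n}} :=
  [set I in NS Lam | [forall J in NS Lam, (J \subset I) ==> (J == I)]]%SET.

(* Only evaluated at differences of two points of a lattice, which have integer
   entries, so that taking real parts loses nothing. *)
Definition wdot (w : 'cV[R]_n) (g : 'cV[C]_n) : R :=
  \sum_j w j 0 * complex.Re (g j 0).

Definition le_w (w : 'cV[R]_n) (g g' : 'cV[C]_n) : Prop := 0 <= wdot w (g' - g).

Definition is_wmin (w : 'cV[R]_n) (X : set 'cV[C]_n) (g : 'cV[C]_n) : Prop :=
  X g /\ forall g', X g' -> le_w w g g'.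

(* On subsets of an exponent lattice the minimum is unique: see wmin_eq. *)
Definition wmin (w : 'cV[R]_n) (X : set 'cV[C]_n) : 'cV[C]_n :=
  xget 0 (is_wmin w X).

Definition Bw (w : 'cV[R]_n) (Lam : set 'cV[C]_n) : {set {set 'I_n}} :=
  [set I in NS Lam | `[< exists2 lam, Lam lam &
     has_lbound [set wdot w (g - lam) | g in stratum Lam I] >]]%SET.

Definition Mw (w : 'cV[R]_n) (Lam : set 'cV[C]_n) : {set {set 'I_n}} :=
  (MinNS Lam :&: Bw w Lam)%SET.

Definition Aw (w : 'cV[R]_n) (Lam : set 'cV[C]_n) : {set {set 'I_n}} :=
  [set I in NS Lam | [forall J in NS Lam, (J \subset I) ==> (J \in Bw w Lam)]]%SET.

Definition vmin (w : 'cV[R]_n) (Lam : set 'cV[C]_n) (I : {set 'I_n}) : 'cV[C]_n :=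
  wmin w (stratum Lam I).

Definition lexp (w : 'cV[R]_n) (phi : logseries) : 'cV[C]_n := wmin w (supp phi).

Definition Sol_dir (beta : 'cV[C]_d) (w : 'cV[R]_n) (Lam : set 'cV[C]_n) :
    set logseries :=
  [set phi | [/\ Flog Lam phi, supp phi `<=` Lam,
     forall P, hyp_ideal beta P -> series_act P phi = 0 &
     phi = 0 \/ exists g, is_wmin w (supp phi) g]].

Definition falling_op (a : 'cV[C]_n) (nu : 'X_{1..n}) : {mpoly C[n]} :=
  \prod_(j < n) \prod_(k < nu j) ('X_j + (a j 0 - k%:R)%:MP).

(* (g - g')_+ for vectors whose difference has integer entries. *)
Definition diff_pos (g g' : 'cV[C]_n) : 'X_{1..n} :=
  pos_part (map_mx (fun z => Num.floor (complex.Re z)) (g - g')).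

(* transit g' g is the operator written d_{g' <- g}. *)
Definition transit (g' g : 'cV[C]_n) : {mpoly C[n]} := falling_op g (diff_pos g g').

(* The exact quotient of transit g' g, which exists by rtransitP. *)
Definition rtransit (g' g : 'cV[C]_n) : {mpoly C[n]} :=
  xget 0 [set q | q * partial_prod (nsupp g' :\: nsupp g)%SET = transit g' g].

Lemma exponent_latticeB beta Lam g g' :
  exponent_lattice beta Lam -> Lam g -> Lam g' ->
  exists2 u, ker_int u & g' - g = map_mx intr u.
Proof.
move=> [lam [_ ->]] [u Lu <-] [v Lv <-]; exists (v - u).
  by rewrite /ker_int /= mulmxBr Lu Lv subrr.
by rewrite map_mxB [_ + map_mx _ v]addrC opprD addrA addrK.
Qed.

Lemma wmin_eq beta Lam w X g : exponent_lattice beta Lam -> L_generic w ->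
  X `<=` Lam -> is_wmin w X g -> wmin w X = g.
Proof.
move=> hL hw XL [Xg ming]; apply: xget_unique => // h [Xh minh].
have [u Lu e] := exponent_latticeB hL (XL _ Xg) (XL _ Xh).
have wE : wdot w (h - g) = \sum_j w j 0 * (u j 0)%:~R.
  by apply: eq_bigr => j _; rewrite e mxE -(rmorph_int (real_complex R)).
have wN : wdot w (g - h) = - wdot w (h - g).
  rewrite -sumrN; apply: eq_bigr => j _; rewrite -[g - h]opprB mxE -mulrN.
  by case: ((h - g) j 0).
have w0 : wdot w (h - g) = 0.
  apply/eqP; rewrite eq_le [X in _ && X]ming // andbT -oppr_ge0 -wN.
  exact: minh.
have [u0|/(hw _ Lu)] := eqVneq u 0; last by rewrite -wE w0 eqxx.
by apply/eqP; rewrite -subr_eq0 e u0 map_mx0.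
Qed.

Lemma rtransitP beta Lam g g' : exponent_lattice beta Lam -> Lam g -> Lam g' ->
  rtransit g' g * partial_prod (nsupp g' :\: nsupp g)%SET = transit g' g.
Proof.
move=> hL Lg Lg'; apply: (@xgetPex _ 0
  [set q | q * partial_prod (nsupp g' :\: nsupp g)%SET = transit g' g]).
have [u _ e] := exponent_latticeB hL Lg' Lg.
rewrite /transit /falling_op; set nu := diff_pos g g'.
have nuE j : nu j = `|(Num.max (u j 0) 0)%R|%N.
  rewrite /nu /diff_pos /pos_part mnmE e !mxE -(rmorph_int (real_complex R)) /=.
  by rewrite intrKfloor.
set J := (_ :\: _)%SET.
have /choice[q qP] j : exists q : {mpoly C[n]},
    \prod_(k < nu j) ('X_j + (g j 0 - k%:R)%:MP) =
    q * (if j \in J then 'X_j else 1).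
  case: ifP => [|_]; last by eexists; rewrite mulr1.
  rewrite !inE => /andP[/asboolPn gj /asboolP[m g'j]].
  have uj : g j 0 = (u j 0 - m.+1%:Z)%:~R.
    have := congr1 (fun M : 'cV[C]_n => M j 0) e; rewrite !mxE g'j opprK => ej.
    by rewrite rmorphB /= -ej addrK.
  case E : (u j 0 - m.+1%:Z) uj => [k0|k0] uj; last first.
    by exfalso; apply: gj; exists k0; rewrite uj NegzE rmorphN.
  have lt : (k0 < nu j)%N.
    rewrite nuE; have -> : u j 0 = (k0 + m.+1)%N by rewrite PoszD -E subrK.
    by rewrite max_l //= addnS ltnS leq_addr.
  exists (\prod_(k < nu j | k != Ordinal lt) ('X_j + (g j 0 - k%:R)%:MP)).
  by rewrite (bigD1 (Ordinal lt)) //= uj subrr mpolyC0 addr0 mulrC.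
exists (\prod_j q j) => /=; rewrite (eq_bigr _ (fun j _ => qP j)) big_split /=.
by rewrite /partial_prod -big_mkcond.
Qed.

(* (P .)^-1 q, for P acting bijectively. *)
Definition dact_inv (P q : {mpoly C[n]}) : {mpoly C[n]} :=
  xget 0 [set p | dact P p = q].

Definition NSidx (Lam : set 'cV[C]_n) := {I : {set 'I_n} | I \in NS Lam}.

Definition coeff_fam (Lam : set 'cV[C]_n) := {ffun NSidx Lam -> {mpoly C[n]}}.

Definition Coeff_dir (w : 'cV[R]_n) (Lam : set 'cV[C]_n) : set (coeff_fam Lam) :=
  [set c : coeff_fam Lam | [/\
     forall I i, dact (Apartial i) (c I) = 0,
     forall I J : NSidx Lam,
       dact (partial_prod (val J :\: val I)%SET) (c I) =
       dact (partial_prod (val I :\: val J)%SET) (c J) &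
     forall I : NSidx Lam, val I \notin Aw w Lam -> c I = 0]].

Definition free_mod (Lam : set 'cV[C]_n) := {ffun NSidx Lam -> {mpoly C[n]}^o}.

Definition free_gen (Lam : set 'cV[C]_n) (I : NSidx Lam) : free_mod Lam :=
  [ffun K => (K == I)%:R].

Inductive Mdir_rel (w : 'cV[R]_n) (Lam : set 'cV[C]_n) : set (free_mod Lam) :=
| Mdir_rel_euler (i : 'I_d) (I : NSidx Lam) :
    Mdir_rel w (Apartial i *: free_gen I)
| Mdir_rel_glue (I J : NSidx Lam) :
    Mdir_rel w (partial_prod (val J :\: val I)%SET *: free_gen I -
                partial_prod (val I :\: val J)%SET *: free_gen J)
| Mdir_rel_kill (K : NSidx Lam) :
    val K \notin Aw w Lam -> Mdir_rel w (free_gen K).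

Definition Mdir (w : 'cV[R]_n) (Lam : set 'cV[C]_n) : lmodType {mpoly C[n]} :=
  quot_mod (@Mdir_rel w Lam).

Definition eps_fam (Lam : set 'cV[C]_n) (I : {set 'I_n}) : coeff_fam Lam :=
  [ffun K : NSidx Lam => (val K == I)%:R].

(* insub picks the index of c given by nsupp g; it is always defined on Lam. *)
Definition phi_series (Lam : set 'cV[C]_n) (lam : 'cV[C]_n) (c : coeff_fam Lam) :
    logseries :=
  fun g => if `[< Lam g >] then
      dact_inv (rtransit lam g)
        (dact (rtransit g lam) (oapp c 0 (insub (nsupp g))))
    else 0.

End Hypergeometric.

(* Main.v *)
From HB Require Import structures.
Require Import Defs.
From mathcomp Require Import all_boot all_order all_algebra.
From mathcomp Require Import boolp classical_sets functions reals complex mpoly.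
From mathcomp Require Import ssrcomplements.
From mathcomp Require monalg.

(** Write [e_I] for the family with [I]-component 1 and all other components 0,
    and think of a series on [Lam] as a family of coefficients [phi g].  A
    monomial in the derivatives moves the coefficient at [g] to another exponent
    by means of [falling_op] ([series_act_monomial]), so the binomials of the
    toric ideal relate the coefficients at any two exponents of [Lam].

    The coefficients of the series attached to [e_I] are constants, and on
    constants an operator acts through its constant term ([dact_const]).  The
    constant term of a falling operator vanishes exactly when the transit makes
    a new coordinate a negative integer; otherwise it is a product of nonzero
    numbers which telescopes like a quotient of Gamma values
    ([falling_op_coeff0_reg], [falling_op_coeff0_eq0], [reg_falling_telescope]).
    Hence the coefficient at [lam + u] in the stratum of [I] is a nonzero
    constant [H 0 / H u], and both sides of a toric relation leading to the
    exponent [g] equal the same number [H 0 / H v] if [nsupp g] is contained in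
    [I], and 0 otherwise.  Minimality of [I] is what makes the two sides agree:
    an exponent of [Lam] whose negative support lies in [I] is in the stratum
    of [I].  The Euler operators hold because [A g = beta] and the coefficients
    are constant.

    A stratum bounded below has a minimum by Dickson's lemma: from a strictly
    decreasing sequence one extracts two terms whose difference can be added
    arbitrarily often without leaving the stratum, so that the direction is
    unbounded below ([stratum_has_wmin]).

    For the equivalences, each of the module, the coefficient space and the
    solution space, when nonzero, exhibits some [I] in [Aw w Lam], and a minimal
    negative support below such an [I] lies in [Mw w Lam] ([Aw_Mw_nonempty]).
    For the module and the coefficient space this is the vanishing imposed
    outside [Aw w Lam].  For a solution with [phi g <> 0], the toric relations
    propagate nonvanishing to every stratum [J] with [J] contained in
    [nsupp g] ([Sol_dir_supp_closed]), so these strata are bounded below because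
    the support is.  Conversely [e_I], for [I] in [Mw w Lam], is a nonzero
    coefficient family, its series is a nonzero solution, and pairing with it
    shows that the generator of index [I] survives in the module. *)

Set Implicit Arguments.
Unset Strict Implicit.
Unset Printing Implicit Defensive.

Import Order.TTheory GRing.Theory Num.Theory.

Local Open Scope ring_scope.
Local Open Scope classical_set_scope.

(** * Constant-coefficient operators on polynomials *)

Section ConstantCoefficientOperators.
Variables (R : realType) (n : nat).
Local Notation C := R[i].
Implicit Types (P Q p q : {mpoly C[n]}).

Lemma dactwE k P p : (msize P <= k)%N ->
  dact P p = \sum_(m : 'X_{1..n < k}) P@_m *: p^`M[m].
Proof.
move=> lek; pose I : subFinType _ := 'X_{1..n < k}.
rewrite /dact (big_mksub I) ?msupp_uniq //=; last first.
  by move=> m /msize_mdeg_lt /leq_trans; apply.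
by rewrite big_rmcond //= => m /memN_msupp_eq0 ->; rewrite scale0r.
Qed.

Lemma dactDl P Q p : dact (P + Q) p = dact P p + dact Q p.
Proof.
pose k := maxn (msize (P + Q)) (maxn (msize P) (msize Q)).
have lP : (msize P <= k)%N by rewrite !leq_max leqnn orbT.
have lQ : (msize Q <= k)%N by rewrite !leq_max leqnn !orbT.
have lPQ : (msize (P + Q)%R <= k)%N by rewrite leq_maxl.
rewrite (dactwE p lP) (dactwE p lQ) (dactwE p lPQ) -big_split /=.
by apply: eq_bigr => m _; rewrite mcoeffD scalerDl.
Qed.

Lemma dactZl c P p : dact (c *: P) p = c *: dact P p.
Proof.
pose k := maxn (msize (c *: P)) (msize P).
have lP : (msize P <= k)%N by rewrite leq_maxr.
have lcP : (msize (c *: P)%R <= k)%N by rewrite leq_maxl.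
rewrite (dactwE p lP) (dactwE p lcP) scaler_sumr.
by apply: eq_bigr => m _; rewrite mcoeffZ scalerA.
Qed.

Lemma dact_is_linear P : linear (dact P).
Proof.
move=> c p q; rewrite /dact scaler_sumr -big_split /=.
apply: eq_bigr => m _.
by rewrite mderivmD mderivmZ scalerDr !scalerA mulrC.
Qed.

HB.instance Definition _ P :=
  GRing.isLinear.Build C {mpoly C[n]} {mpoly C[n]} _ (dact P) (dact_is_linear P).

Lemma dactX m p : dact 'X_[m] p = p^`M[m].
Proof. by rewrite /dact msuppX big_seq1 mcoeffX eqxx scale1r. Qed.

Lemma dactC c p : dact c%:MP p = c *: p.
Proof.
by rewrite -[c%:MP]mulr1 mul_mpolyC dactZl -mpolyX0 dactX mderivm0m.
Qed.

Lemma dactM P Q p : dact (P * Q) p = dact P (dact Q p).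
Proof.
elim/mpolyind: P => [|c m P _ _ IH].
  by rewrite mul0r -mpolyC0 !dactC !scale0r.
rewrite mulrDl !dactDl IH; congr (_ + _).
rewrite -scalerAl !dactZl dactX; congr (_ *: _).
elim/mpolyind: Q {IH} => [|e k Q _ _ IH].
  by rewrite mulr0 -mpolyC0 !dactC !scale0r raddf0.
rewrite mulrDr !dactDl IH mderivmD; congr (_ + _).
by rewrite -scalerAr !dactZl mderivmZ -mpolyXD !dactX addmC mderivmDm.
Qed.

Lemma mcoeff_dact P p k :
  (dact P p)@_k = \sum_(m <- msupp P) P@_m * (p^`M[m])@_k.
Proof. by rewrite /dact raddf_sum; apply: eq_bigr => m _ /=; rewrite mcoeffZ. Qed.

Lemma dact_const P c : dact P c%:MP = (P@_0%MM * c)%:MP.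
Proof.
apply/mpolyP => k; rewrite mcoeff_dact mcoeffC.
have E (m : 'X_{1..n}) : ((c%:MP : {mpoly C[n]})^`M[m])@_k =
    c *+ ((m == 0%MM) && (k == 0%MM)).
  rewrite mcoeff_mderivm mcoeffC -[(m + k == 0)%MM]mdeg_eq0 mdegD addn_eq0 !mdeg_eq0.
  have [->|_] := eqVneq m 0%MM; last by rewrite mulr0 mul0rn mulr0n.
  rewrite add0m big1 ?mulr1n ?mulr_natr // => i _.
  by rewrite mnm0E ffactn0.
rewrite (eq_bigr _ (fun m _ => congr1 _ (E m))).
have [k0|_] := eqVneq k 0%MM; last first.
  by rewrite mulr0 big1 // => m _; rewrite andbF mulr0.
rewrite mulr1.
have [z|z] := boolP (0%MM \in msupp P).
  rewrite (bigD1_seq 0%MM) ?msupp_uniq //= eqxx mulr1n big1 ?addr0 // => m /negPf ->.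
  by rewrite mulr0n mulr0.
rewrite (memN_msupp_eq0 z) mul0r big_seq big1 // => m mP.
by case: eqP mP z => [-> -> //|]; rewrite mulr0.
Qed.

(** A nonzero constant term is invertible up to operators lowering the degree,
    so the leading coefficient survives. *)
Lemma dact_neq0 P p : P@_0%MM != 0 -> p != 0 -> dact P p != 0.
Proof.
move=> P0 p0; apply/eqP => /(congr1 (mcoeff (mlead p))).
rewrite mcoeff_dact mcoeff0.
have zP : 0%MM \in msupp P by rewrite -[_ \in _]negbK -mcoeff_eq0.
rewrite (bigD1_seq 0%MM) ?msupp_uniq //= big1 ?addr0 => [|m m0].
  by rewrite mderivm0m => /eqP; rewrite mulf_eq0 (negPf P0) mleadc_eq0 (negPf p0).
rewrite mcoeff_mderivm (mcoeff_gt_mlead (p := p)) ?mul0rn ?mulr0 //.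
rewrite lt_neqAle (lem_leo (lem_addl _ _)) andbT; apply: contra m0 => /eqP/(congr1 mdeg)/eqP.
by rewrite mdegD -{1}[mdeg (mlead p)]add0n eqn_add2r eq_sym mdeg_eq0.
Qed.

Lemma dact_inv_eq P p q : P@_0%MM != 0 -> dact P p = q -> dact_inv P q = p.
Proof.
move=> P0 <-; apply: xget_unique => //= r e; apply/eqP; rewrite -subr_eq0.
apply: contraTT isT => /(dact_neq0 P0).
by rewrite linearB /= e subrr eqxx.
Qed.

End ConstantCoefficientOperators.

(** * Action of monomials on logarithmic series *)

Section WeylScalars.
Variables (K : comNzRingType) (n : nat).

Fact weylC_is_zmod_morphism : zmod_morphism (@weylC K n).
Proof. by move=> a b; rewrite /weylC /weyl_pi monalg.monalgUB quot_piB. Qed.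
HB.instance Definition _ := GRing.isZmodMorphism.Build K (weyl K n) (@weylC K n)
  weylC_is_zmod_morphism.

Fact weylC_is_monoid_morphism : monoid_morphism (@weylC K n).
Proof.
by split=> [|a b]; rewrite // /weylC /weyl_pi monalg.mpolyCM quot_piM.
Qed.
HB.instance Definition _ := GRing.isMonoidMorphism.Build K (weyl K n) (@weylC K n)
  weylC_is_monoid_morphism.

End WeylScalars.

Section MonomialAction.
Variables (R : realType) (n : nat).
Local Notation C := R[i].
Implicit Types (phi : logseries R n) (g : 'cV[C]_n) (m : 'X_{1..n}).

Definition mnm_vec m : 'cV[C]_n := \col_j (m j)%:R.

Lemma series_d_dact j phi g :
  series_d j phi g = dact ('X_j + (g j 0 + 1)%:MP) (phi (g + unit_vec R j)).
Proof. by rewrite dactDl dactC dactX mderivmU1m addrC. Qed.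

Lemma series_act_exp j k phi g :
  series_act (weylD C j ^+ k) phi g =
  dact (\prod_(l < k) ('X_j + (g j 0 + k%:R - l%:R)%:MP))
    (phi (g + k%:R *: unit_vec R j)).
Proof.
elim: k phi g => [|k IH] phi g.
  by rewrite expr0 series_act1 big_ord0 -mpolyC1 dactC !scale0r scale1r addr0.
rewrite exprS series_actM series_actDer series_d_dact IH -dactM.
rewrite big_ord_recr /= [RHS]/dact; congr (dact _ (phi _)); last first.
  by rewrite -addrA -{1}[unit_vec R j]scale1r -scalerDl -natr1 [1 + _]addrC.
rewrite mulrC -natr1; congr (_ * ('X_j + _%:MP)); last first.
  by rewrite -addrA [k%:R + 1]addrC addrK.
apply: eq_bigr => l _; congr ('X_j + (_ - _)%:MP).
by rewrite mxE unit_vecE eqxx -addrA [1 + _]addrC.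
Qed.

(** The letters commute and act on different coordinates, so the powers of the
    single derivatives multiply to one falling operator. *)
Lemma series_act_monomial m phi g :
  series_act (weyl_of_partial 'X_[m]) phi g =
  dact (falling_op (g + mnm_vec m) m) (phi (g + mnm_vec m)).
Proof.
rewrite /weyl_of_partial mmapX /mmap1 /falling_op.
pose vec (r : seq 'I_n) : 'cV[C]_n := \sum_(j <- r) (m j)%:R *: unit_vec R j.
have vecE r i : uniq r -> vec r i 0 = if i \in r then (m i)%:R else 0.
  elim: r => [|j r IH] /=; first by rewrite /vec big_nil mxE.
  move=> /andP[jr ur]; rewrite /vec big_cons -/(vec r) mxE IH // mxE unit_vecE inE.
  have [->|_] := eqVneq i j; first by rewrite (negPf jr) mulr1 addr0.
  by rewrite mulr0 add0r.
have -> : mnm_vec m = vec (index_enum 'I_n).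
  apply/matrixP => i k; rewrite (ord1 k) vecE ?index_enum_uniq //.
  by rewrite mem_index_enum mxE.
elim: (index_enum _) (index_enum_uniq 'I_n) phi g => [|j r IH] /= => [_|/andP[jr ur]] phi g.
  by rewrite /vec !big_nil series_act1 -mpolyC1 dactC scale1r addr0.
rewrite !big_cons series_actM series_act_exp IH // -dactM.
have -> : vec (j :: r) = (m j)%:R *: unit_vec R j + vec r by rewrite /vec big_cons.
rewrite addrA; congr (dact (_ * _) _).
  apply: eq_bigr => k _; congr ('X_j + (_ - _)%:MP).
  have -> (x y z : 'cV[C]_n) : (x + y + z) j 0 = x j 0 + y j 0 + z j 0.
    by rewrite mxE [(x + y) j 0]mxE.
  have -> : ((m j)%:R *: unit_vec R j) j 0 = (m j)%:R.
    by rewrite mxE unit_vecE eqxx mulr1.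
  by rewrite vecE // (negPf jr) addr0.
Qed.

End MonomialAction.

(** * Constant terms of the transit operators *)

Section NegativeSupport.
Variables (R : realType) (n : nat).
Local Notation C := R[i].
Implicit Types (g a : 'cV[C]_n) (u : 'cV[int]_n) (nu : 'X_{1..n}).

Lemma nsupp_intP g j : j \in nsupp g -> exists2 z : int, z < 0 & g j 0 = z%:~R.
Proof.
rewrite inE => /asboolP[k e]; by exists (Negz k).
Qed.

Lemma in_nsupp_int g j (z : int) : g j 0 = z%:~R -> (j \in nsupp g) = (z < 0).
Proof.
move=> e; apply/idP/idP => [/nsupp_intP[y y0]|].
  by rewrite e => /intr_inj ->.
by case: z e => [//|k] e _; rewrite inE; apply/asboolP; exists k.
Qed.

(** Replacing the zero factors of a falling factorial by 1 is the effect on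
    constant terms of dividing a transit operator by its factors
    [d/dy_j]. *)
Definition nonzero_part (z : C) : C := if z == 0 then 1 else z.

Lemma nonzero_part_neq0 z : nonzero_part z != 0.
Proof. by rewrite /nonzero_part; case: ifP => [_|/negbT //]; rewrite oner_eq0. Qed.

Definition reg_falling a nu : C :=
  \prod_(j < n) \prod_(k < nu j) nonzero_part (a j 0 - k%:R).

Lemma reg_falling_neq0 a nu : reg_falling a nu != 0.
Proof.
by apply/prodf_neq0 => j _; apply/prodf_neq0 => k _; apply: nonzero_part_neq0.
Qed.

Lemma mcoeff0_prod (I : Type) (r : seq I) (P : pred I) (F : I -> {mpoly C[n]}) :
  (\prod_(i <- r | P i) F i)@_0 = \prod_(i <- r | P i) (F i)@_0.
Proof. exact: rmorph_prod. Qed.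

Lemma mcoeff0_linear j (c : C) : ('X_j + c%:MP : {mpoly C[n]})@_0 = c.
Proof. by rewrite mcoeffD mcoeffX mnm1_eq0 mcoeffC eqxx mulr1 add0r. Qed.

Lemma falling_op_coeff0 a nu :
  (falling_op a nu)@_0 = \prod_(j < n) \prod_(k < nu j) (a j 0 - k%:R).
Proof.
rewrite /falling_op mcoeff0_prod; apply: eq_bigr => j _.
by rewrite mcoeff0_prod; apply: eq_bigr => k _; rewrite mcoeff0_linear.
Qed.

(** A zero factor at [j] means that [a j] is a natural number below [nu j], which
    is to say that [j] enters the negative support. *)
Lemma falling_op_coeff0_reg a nu : nsupp (a - mnm_vec R nu) \subset nsupp a ->
  (falling_op a nu)@_0 = reg_falling a nu.
Proof.
move=> /fintype.subsetP sub; rewrite falling_op_coeff0.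
apply: eq_bigr => j _; apply: eq_bigr => k _; rewrite /nonzero_part.
case: eqP => [/eqP|//]; rewrite subr_eq0 => /eqP ak; exfalso.
have aj : a j 0 = k%:Z%:~R by rewrite ak.
have : j \in nsupp (a - mnm_vec R nu).
  rewrite (in_nsupp_int (z := k%:Z - (nu j)%:Z)) ?subr_lt0 ?ltz_nat ?ltn_ord //.
  by rewrite rmorphB /= -aj !mxE.
by move/sub; rewrite (in_nsupp_int aj).
Qed.

Lemma falling_op_coeff0_eq0 a nu : ~~ (nsupp (a - mnm_vec R nu) \subset nsupp a) ->
  (falling_op a nu)@_0 = 0.
Proof.
move=> /subsetPn[j /nsupp_intP[z z0 e] ja]; rewrite falling_op_coeff0.
have aj : a j 0 = (z + (nu j)%:Z)%:~R by rewrite rmorphD /= -e !mxE subrK.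
move: ja; rewrite (in_nsupp_int aj) -leNgt.
case E: (z + (nu j)%:Z) aj => [k|//] aj _.
have lt : (k < nu j)%N by rewrite -ltz_nat -E gtrDr.
by rewrite (bigD1 j) //= (bigD1 (Ordinal lt)) //= aj subrr !mul0r.
Qed.

Lemma diff_posE g g' u : g - g' = map_mx intr u -> diff_pos g g' = pos_part u.
Proof.
rewrite /diff_pos => ->; apply/mnmP => j.
by rewrite !mnmE !mxE -(rmorph_int (real_complex R)) /= intrKfloor.
Qed.

Lemma pos_partE u j : (pos_part u j)%:Z = Num.max (u j 0) 0.
Proof. by rewrite mnmE gez0_abs // le_max lexx orbT. Qed.

Lemma pos_partB u j : u j 0 - (pos_part u j)%:Z = - (pos_part (- u) j)%:Z.
Proof.
rewrite !pos_partE mxE; case: (lerP 0 (u j 0)) => h.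
  by rewrite subrr max_r ?oppr0 // oppr_le0.
by rewrite subr0 max_l ?opprK // oppr_ge0 ltW.
Qed.

Lemma mnm_vec_pos_partB u :
  map_mx intr u - mnm_vec R (pos_part u) = - mnm_vec R (pos_part (- u)) :> 'cV[C]_n.
Proof.
apply/matrixP => j k; rewrite !mxE -[(pos_part u j)%:R]/((pos_part u j)%:Z%:~R).
by rewrite (ord1 k) -rmorphB /= pos_partB rmorphN.
Qed.

(** Each coordinate entering the negative support has exactly one factor without
    constant term, namely ['X_j]; cancelling it leaves the nonzero factors. *)
Lemma rtransit_coeff0 d (A : 'M[int]_(d, n)) beta Lam g g' u :
  exponent_lattice A beta Lam -> Lam g -> Lam g' -> g - g' = map_mx intr u ->
  (rtransit g' g)@_0 = reg_falling g (pos_part u).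
Proof.
move=> hL Lg Lg' e.
pose q : {mpoly C[n]} := \prod_(j < n)
  \prod_(k < pos_part u j | g j 0 != k%:R) ('X_j + (g j 0 - k%:R)%:MP).
suff -> : rtransit g' g = q.
  rewrite mcoeff0_prod; apply: eq_bigr => j _; rewrite mcoeff0_prod big_mkcond.
  apply: eq_bigr => k _; rewrite mcoeff0_linear /nonzero_part subr_eq0.
  by case: eqP.
have pp0 (J : {set 'I_n}) : partial_prod R J != 0.
  by apply/prodf_neq0 => j _; rewrite -msize_poly_eq0 msizeX mdeg1.
apply: (mulIf (pp0 (nsupp g' :\: nsupp g)%SET)); rewrite (rtransitP hL Lg Lg').
rewrite /transit (diff_posE e) /falling_op /partial_prod [X in _ * X]big_mkcond /=.
rewrite -big_split /=; apply: eq_bigr => j _.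
have ej : g j 0 = g' j 0 + (u j 0)%:~R.
  by have := congr1 (fun M : 'cV[C]_n => M j 0) e; rewrite !mxE => <-; rewrite subrKC.
case: ifP => [|jn]; last first.
  rewrite mulr1; apply: eq_bigl => k; apply/esym/negP => /eqP gk.
  have gj : g j 0 = k%:Z%:~R by rewrite gk.
  move: jn; rewrite finset.inE (in_nsupp_int gj) /=.
  rewrite (in_nsupp_int (z := k%:Z - u j 0)); last first.
    by rewrite rmorphB /= -gj ej addrK.
  rewrite subr_lt0 => /negP; apply; have := ltn_ord k.
  by rewrite -ltz_nat pos_partE lt_max => /orP[].
rewrite finset.inE => /andP[jg /nsupp_intP[z z0 g'j]].
have gj : g j 0 = (z + u j 0)%:~R by rewrite ej g'j rmorphD.
move: jg; rewrite (in_nsupp_int gj) -leNgt.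
case E : (z + u j 0) gj => [k|//] gj _.
have lt : (k < pos_part u j)%N.
  by rewrite -ltz_nat pos_partE -E lt_max gtrDr z0.
rewrite (bigD1 (Ordinal lt)) //= gj subrr mpolyC0 addr0 mulrC; congr (_ * _).
by apply: eq_bigl => l; rewrite -val_eqE /= eqr_nat eq_sym.
Qed.

(** [h z] plays the role of the Gamma function at [a + z + 1], with the zeros and
    poles removed from its functional equation. *)
Lemma nonzero_part_telescope (a : C) : exists2 h : int -> C, forall z, h z != 0 &
  forall z k, \prod_(l < k) nonzero_part (a + z%:~R - l%:R) * h (z - k%:Z) = h z.
Proof.
pose h (z : int) := match z with
  | Posz m => \prod_(l < m) nonzero_part (a + l.+1%:R)
  | Negz m => (\prod_(l < m.+1) nonzero_part (a - l%:R))^-1 end.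
exists h.
  by case=> m; rewrite ?invr_eq0; apply/prodf_neq0 => l _; apply: nonzero_part_neq0.
have step z : nonzero_part (a + z%:~R) * h (z - 1) = h z.
  case: z => [[|m]|m].
  - rewrite addr0 sub0r /= big_ord0 big_ord1 subr0 divff //.
    exact: nonzero_part_neq0.
  - by rewrite -addn1 PoszD addrK -PoszD addn1 [RHS]big_ord_recr mulrC.
  have -> : Negz m - 1 = Negz m.+1 by rewrite !NegzE -opprD -PoszD addn1.
  rewrite /= [in LHS]big_ord_recr /= invfM mulrCA NegzE rmorphN divff ?mulr1 //.
  exact: nonzero_part_neq0.
move=> z; elim=> [|k IH]; first by rewrite big_ord0 mul1r subr0.
rewrite big_ord_recr /= -mulrA -addn1 PoszD opprD addrA.
by rewrite -[a + _ - _]addrA -[k%:R]/(k%:Z%:~R) -rmorphB step IH.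
Qed.

(** With a single [H] for the whole lattice, the cocycle identities between
    transit constants reduce to cancellation of values of [H]. *)
Lemma reg_falling_telescope a : exists2 H : 'cV[int]_n -> C, forall u, H u != 0 &
  forall u nu, reg_falling (a + map_mx intr u) nu *
    H (u - \col_j (nu j)%:Z) = H u.
Proof.
have /choice[h hP] (j : 'I_n) : exists h : int -> C, (forall z, h z != 0) /\
    forall z k, \prod_(l < k) nonzero_part (a j 0 + z%:~R - l%:R) * h (z - k%:Z) = h z.
  by have [h h0 hP] := nonzero_part_telescope (a j 0); exists h.
exists (fun u => \prod_j h j (u j 0)) => [u|u nu].
  by apply/prodf_neq0 => j _; case: (hP j).
rewrite -big_split /=; apply: eq_bigr => j _; rewrite !mxE.
by case: (hP j) => _ ->.
Qed.

End NegativeSupport.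

(** * Minima of bounded strata *)

Section Dickson.

(** Repeatedly jump to an index at which [f] is least among the later ones. *)
Lemma nondecreasing_subsequence (f : nat -> nat) :
  exists2 h : nat -> nat, {homo h : a b / (a < b)%N} & {homo f \o h : a b / (a <= b)%N}.
Proof.
have /choice[next nextP] (N : nat) :
    exists k, (N <= k)%N /\ forall l, (N <= l)%N -> (f k <= f l)%N.
  have exv : exists v, `[< exists2 k, (N <= k)%N & f k = v >].
    by exists (f N); apply/asboolP; exists N.
  case: (ex_minnP exv) => v /asboolP[k Nk <-] vmin; exists k; split=> // l Nl.
  by apply: vmin; apply/asboolP; exists l.
pose h := fix h k := if k is l.+1 then next (h l).+1 else next 0%N.
have h_lt k : (h k < h k.+1)%N by have [] := nextP (h k).+1.
exists h; first exact: homo_ltn ltn_trans h_lt.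
apply: homo_leq leq_trans _ => // k.
case: k => [|k]; first exact: (nextP 0%N).2.
by apply: (nextP (h k).+1).2; apply: ltn_trans (h_lt k) (h_lt k.+1).
Qed.

(** Dickson's lemma: thin out the indices once for each [i], so that every [f i]
    becomes nondecreasing on the remaining ones. *)
Lemma dickson_pair (I : finType) (f : I -> nat -> nat) :
  exists a b, (a < b)%N /\ forall i, (f i a <= f i b)%N.
Proof.
suff [h h_lt fh] : exists2 h : nat -> nat, {homo h : a b / (a < b)%N} &
    {in enum I, forall i, {homo f i \o h : a b / (a <= b)%N}}.
  exists (h 0%N), (h 1%N); split=> [|i]; first exact: h_lt.
  by apply: fh; rewrite ?mem_enum.
elim: (enum I) => [|i r [h h_lt fh]]; first by exists id.
have [k k_lt fk] := nondecreasing_subsequence (f i \o h).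
exists (h \o k) => [a b /k_lt/h_lt //|j]; rewrite in_cons => /predU1P[-> //|jr].
move=> a b ab; apply: (fh j jr); exact: (ltnW_homo k_lt).
Qed.

End Dickson.

Section BoundedStrata.
Variables (R : realType) (d n : nat) (A : 'M[int]_(d, n)).
Local Notation C := R[i].
Implicit Types (g : 'cV[C]_n) (u : 'cV[int]_n) (w : 'cV[R]_n).

Lemma wdotD w g g' : wdot w (g + g') = wdot w g + wdot w g'.
Proof.
rewrite /wdot -big_split; apply: eq_bigr => j _ /=; rewrite mxE -mulrDr.
by case: (g j 0) => ? ?; case: (g' j 0).
Qed.

Lemma wdotMn w g t : wdot w (g *+ t) = wdot w g *+ t.
Proof.
elim: t => [|t IH]; last by rewrite !mulrS wdotD IH.
by rewrite !mulr0n /wdot big1 // => j _; rewrite mxE mulr0.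
Qed.

Lemma exponent_lattice_shift beta Lam g u : exponent_lattice A beta Lam ->
  Lam g -> ker_int A u -> Lam (g + map_mx intr u).
Proof.
move=> [lam [_ ->]] [v Lv <-] Lu; exists (v + u); last by rewrite map_mxD addrA.
by rewrite /ker_int /= mulmxDr Lv Lu addr0.
Qed.

(** Under one translation an integral entry keeps its sign and does not approach
    zero, so it keeps its sign under all further ones; a non-integral entry
    stays non-integral. *)
Lemma nsupp_iterate g u t : nsupp (g + map_mx intr u) = nsupp g ->
  (forall j (z : int), g j 0 = z%:~R -> (`|z|%R <= `|z + u j 0|%R)%R) ->
  nsupp (g + map_mx intr u *+ t) = nsupp g.
Proof.
move=> e le; apply/setP => j.
have entry k : (g + map_mx intr u *+ k) j 0 = g j 0 + (u j 0)%:~R *+ k.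
  by rewrite mxE mulmxnE mxE.
have [[z gz]|nz] := pselect (exists z : int, g j 0 = z%:~R); last first.
  apply/idP/idP => /nsupp_intP[z _ gz]; case: nz; last by exists z.
  by exists (z - u j 0 *+ t); rewrite rmorphB rmorphMn /= -gz entry addrK.
have E k : (j \in nsupp (g + map_mx intr u *+ k)) = (z + u j 0 *+ k < 0).
  by apply: in_nsupp_int; rewrite entry gz rmorphD rmorphMn.
have := congr1 (fun J : {set 'I_n} => j \in J) e.
rewrite -[map_mx intr u]mulr1n !E mulr1n (in_nsupp_int gz).
have := le j z gz.
case: (ltrP z 0) => z0 lez zu.
  suff : u j 0 <= 0 by move=> u0; apply: ltr_wnDr; rewrite // mulrn_wle0.
  by move: lez; rewrite !ltr0_norm // ?lerN2 ?gerDl.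
suff : 0 <= u j 0 by move=> u0; apply/negbTE; rewrite -leNgt addr_ge0 // mulrn_wge0.
move/negbT: zu; rewrite -leNgt => zu; move: lez.
by rewrite !ger0_norm ?lerDl.
Qed.

(** Dickson's lemma is applied to the moduli of the integral entries, whose signs
    are constant on the stratum; the other entries are unconstrained. *)
Lemma stratum_has_wmin beta Lam w I : exponent_lattice A beta Lam ->
  I \in Bw w Lam -> exists g, is_wmin w (stratum Lam I) g.
Proof.
move=> hL; rewrite finset.inE => /andP[]; rewrite finset.inE => /asboolP[g0 Sg0].
move=> /asboolP[lam Lam_lam [M Mlb]].
apply: contrapT => /forallNP nomin.
have /choice[F FP] g : exists g', stratum Lam I g ->
    stratum Lam I g' /\ wdot w (g' - g) < 0.
  have [Sg|nSg] := pselect (stratum Lam I g); last by exists g.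
  apply: contrapT => /forallNP no; apply: (nomin g); split=> // g' Sg'.
  rewrite /le_w leNgt; apply/negP => lt.
  by apply: (no g').
pose s k := iter k F g0.
have Ss k : stratum Lam I (s k) by elim: k => // k /FP[].
have s_lt : {homo s : a b / (a < b)%N >-> wdot w (b - a) < 0}.
  apply: (@homo_ltn _ s (fun a b => wdot w (b - a) < 0)) => [y x z xy yz|k].
    by rewrite -(subrK y z) -addrA wdotD ltr_nDl // ltW.
  by have [] := FP _ (Ss k).
(* At non-integral entries the value of f is irrelevant. *)
pose f (j : 'I_n) k := `|(Num.floor (complex.Re (s k j 0)))%R|%N.
have [a [b [ab fab]]] := dickson_pair f.
have [La Ia] := Ss a; have [Lb Ib] := Ss b.
have [u Lu e] := exponent_latticeB hL La Lb.
have ray t : stratum Lam I (s a + map_mx intr u *+ t).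
  split.
    rewrite -raddfMn; apply: (exponent_lattice_shift hL La).

    by rewrite /ker_int /= -scaler_nat -scalemxAr Lu scaler0.
  have same : nsupp (s a + map_mx intr u) = nsupp (s a) by rewrite -e subrKC Ia.
  rewrite /= (nsupp_iterate t same) // => j z sz.
  have floorE (y : int) : Num.floor (complex.Re (y%:~R : C)) = y.
    by rewrite -(rmorph_int (real_complex R)) /= intrKfloor.
  have := fab j; rewrite /f sz floorE.
  have -> : s b j 0 = (z + u j 0)%:~R; last by rewrite floorE -lez_nat !abszE.
  have := congr1 (fun X : 'cV[C]_n => X j 0) e; rewrite !mxE sz => /eqP.
  by rewrite subr_eq addrC rmorphD => /eqP.
have neg := s_lt _ _ ab; rewrite e in neg.
have lb t : M <= wdot w (s a - lam) + wdot w (map_mx intr u) *+ t.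
  by rewrite -wdotMn -wdotD addrAC; apply: Mlb; exists (s a + map_mx intr u *+ t) => //.
set c := wdot w (s a - lam) in lb; set dl := wdot w _ in neg lb.
(* Far enough along the ray the lower bound M is violated. *)
have := lb (Num.bound ((c - M) / - dl)); apply/negP; rewrite -ltNge.
have dl0 : 0 < - dl by rewrite oppr_gt0.
have := archi_boundP (divr_ge0 _ (ltW dl0) : 0 <= (c - M) / - dl).
rewrite subr_ge0; have := lb 0%N; rewrite mulr0n addr0 => cM /(_ cM).
by rewrite ltr_pdivrMr // mulrN mulr_natl ltrBlDr addrC -ltrBlDr opprK.
Qed.

End BoundedStrata.

(** * Series annihilated by the hypergeometric ideal *)

Section HypergeometricSystem.
Variables (R : realType) (d n : nat) (A : 'M[int]_(d, n)).
Local Notation C := R[i].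
Implicit Types (phi : logseries R n) (g : 'cV[C]_n) (u : 'cV[int]_n).

Lemma series_act0 phi : series_act 0 phi = 0.
Proof.
by have := series_actD 0 0 phi; rewrite addr0 -[LHS]addr0 => /addrI.
Qed.

Lemma series_act_v0 (P : weyl C n) : series_act P (0 : logseries R n) = 0.
Proof. exact: free_act_v0. Qed.

Lemma series_act_sum I (r : seq I) (F : I -> weyl C n) phi :
  series_act (\sum_(i <- r) F i) phi = \sum_(i <- r) series_act (F i) phi.
Proof.
elim: r => [|i r IH]; first by rewrite !big_nil series_act0.
by rewrite !big_cons series_actD IH.
Qed.

Lemma series_actB (P Q : weyl C n) phi :
  series_act (P - Q) phi = series_act P phi - series_act Q phi.
Proof. by apply/eqP; rewrite eq_sym subr_eq -series_actD subrK. Qed.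

Lemma series_act_binomial (p q : 'X_{1..n}) phi g :
  series_act (weyl_of_partial ('X_[p] - 'X_[q])) phi g =
  dact (falling_op (g + mnm_vec R p) p) (phi (g + mnm_vec R p)) -
  dact (falling_op (g + mnm_vec R q) q) (phi (g + mnm_vec R q)).
Proof. by rewrite /weyl_of_partial mmapB series_actB -!series_act_monomial. Qed.

Lemma series_act_euler i c phi g :
  series_act (weyl_euler R A i - weylC n c) phi g =
  \sum_j (A i j)%:~R *: (g j 0 *: phi g + (phi g)^`M(j)) - c *: phi g.
Proof.
rewrite series_actB series_actC.
have fB (x y : logseries R n) h : (x - y) h = x h - y h by [].
rewrite fB; congr (_ - _); rewrite series_act_sum.
have fsum (F : 'I_n -> logseries R n) h : (\sum_j F j) h = \sum_j F j h.
  by apply: (big_morph (fun f : logseries R n => f h)).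
rewrite fsum; apply: eq_bigr => j _.
rewrite -(rmorph_int (@weylC C n)) !series_actM series_actC series_actX series_actDer.
rewrite -[LHS]/(_ *: series_x _ _ _) /series_x /series_d subrK; congr (_ *: (_ *: _ + _)).
by rewrite !mxE !eqxx subrK.
Qed.

Lemma weyl_of_partialD (p q : {mpoly C[n]}) :
  weyl_of_partial (p + q) = weyl_of_partial p + weyl_of_partial q.
Proof. exact: mmapD. Qed.

Lemma weyl_of_partialZ c (p : {mpoly C[n]}) :
  weyl_of_partial (c *: p) = weylC n c * weyl_of_partial p.
Proof. exact: mmapZ. Qed.

Lemma weyl_of_partial0 : weyl_of_partial 0 = 0 :> weyl C n.
Proof. exact: mmap0. Qed.

(** A monomial multiple of a binomial is again a binomial with the same exponent
    difference; taking the relations for all pairs [p], [q], also with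
    overlapping supports, therefore makes the hypothesis stable under
    multiplication by monomials. *)
Lemma series_act_toric_ideal phi :
  (forall (p q : 'X_{1..n}) u, ker_int A u ->
     (forall j, (p j)%:Z - (q j)%:Z = u j 0) -> forall g,
     dact (falling_op (g + mnm_vec R p) p) (phi (g + mnm_vec R p)) =
     dact (falling_op (g + mnm_vec R q) q) (phi (g + mnm_vec R q))) ->
  forall q : {mpoly C[n]}, toric_ideal A q -> series_act (weyl_of_partial q) phi = 0.
Proof.
move=> toric _ [k [a [b [Gb ->]]]].
apply: (big_ind (fun q : {mpoly C[n]} => series_act (weyl_of_partial q) phi = 0)).
- by rewrite weyl_of_partial0 series_act0.
- move=> p q p0 q0; rewrite weyl_of_partialD series_actD.
  exact: etrans (congr2 +%R p0 q0) (addr0 _).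
move=> l _; case: (Gb l) => u Lu <-.
have -> (p q : {mpoly C[n]}) : (p : {mpoly C[n]}^o) *: (q : {mpoly C[n]}^o) = p * q.
  by [].
elim/mpolyind: (a l) => [|c m Q _ _ IH].
  by rewrite mul0r weyl_of_partial0 series_act0.
rewrite mulrDl weyl_of_partialD series_actD -scalerAl weyl_of_partialZ.
apply: etrans (congr2 +%R _ IH) (addr0 _); rewrite series_actM series_actC mulrBr -!mpolyXD.
apply/funext => g; rewrite -[LHS]/(_ *: series_act _ _ g) series_act_binomial.
rewrite (toric _ (m + pos_part (- u))%MM u) ?subrr ?scaler0 // => j.
rewrite !mnmDE !PoszD opprD addrACA subrr add0r.
by rewrite -[RHS](subrK (pos_part u j)%:Z) pos_partB addrC.
Qed.

Lemma hyp_ideal_act_eq0 (beta : 'cV[C]_d) phi :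
  (forall (p q : 'X_{1..n}) u, ker_int A u ->
     (forall j, (p j)%:Z - (q j)%:Z = u j 0) -> forall g,
     dact (falling_op (g + mnm_vec R p) p) (phi (g + mnm_vec R p)) =
     dact (falling_op (g + mnm_vec R q) q) (phi (g + mnm_vec R q))) ->
  (forall i g, \sum_j (A i j)%:~R *: (g j 0 *: phi g + (phi g)^`M(j)) =
     beta i 0 *: phi g) ->
  forall P, hyp_ideal A beta P -> series_act P phi = 0.
Proof.
move=> toric euler _ [k [a [b [Gb ->]]]].
rewrite series_act_sum big1 // => l _; rewrite series_actM.
suff -> : series_act (b l) phi = 0 by rewrite series_act_v0.
case: (Gb l) => [[q Hq <-]|[i _ <-]]; last first.
  by apply/funext => g; rewrite series_act_euler euler subrr.
exact: series_act_toric_ideal.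
Qed.

Lemma Sol_dir_transit beta w Lam phi g g' u : Sol_dir A beta w Lam phi ->
  ker_int A u -> g - g' = map_mx intr u ->
  dact (falling_op g (pos_part u)) (phi g) =
  dact (falling_op g' (pos_part (- u))) (phi g').
Proof.
move=> [_ _ sol _] Lu e.
pose P := weyl_of_partial ('X_[pos_part u] - 'X_[pos_part (- u)]) : weyl C n.
have HP : hyp_ideal A beta P.
  exists 1%N, (fun=> 1), (fun=> P); split; last by rewrite big_ord1 scale1r.
  move=> _; left; exists ('X_[pos_part u] - 'X_[pos_part (- u)]) => //.
  exists 1%N, (fun=> 1), (fun=> 'X_[pos_part u] - 'X_[pos_part (- u)]).
  by split; [move=> _; exists u | rewrite big_ord1 scale1r].
have := congr1 (fun f : logseries R n => f (g - mnm_vec R (pos_part u))) (sol P HP).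
rewrite series_act_binomial subrK.
have -> : g - mnm_vec R (pos_part u) + mnm_vec R (pos_part (- u)) = g'.
  by rewrite -(subrK g' g) e [_ + g' - _]addrAC mnm_vec_pos_partB addrAC addNr add0r.
by move/eqP; rewrite subr_eq0 => /eqP.
Qed.

End HypergeometricSystem.

(** * Minimal supports, coefficient families and the module *)

Section MinimalSupports.
Variables (R : realType) (d n : nat) (A : 'M[int]_(d, n)).
Local Notation C := R[i].
Variables (beta : 'cV[C]_d) (w : 'cV[R]_n) (Lam : set 'cV[C]_n).
Hypothesis hL : exponent_lattice A beta Lam.
Implicit Types (g : 'cV[C]_n) (u : 'cV[int]_n) (I J : {set 'I_n}).

Lemma NSP I : reflect (stratum Lam I !=set0) (I \in NS Lam).
Proof. by rewrite [_ \in _]finset.in_set; apply: asboolP. Qed.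

Lemma NS_nsupp g : Lam g -> nsupp g \in NS Lam.
Proof. by move=> Lg; apply/NSP; exists g. Qed.

Lemma MinNSP I : reflect (I \in NS Lam /\ forall J, J \in NS Lam -> J \subset I -> J = I)
  (I \in MinNS Lam).
Proof.
rewrite [_ \in MinNS _]finset.in_set; apply: (iffP andP) => -[NI minI]; split=> //.
  by move=> J NJ JI; apply/eqP; apply: (implyP (forall_inP minI J NJ)).
by apply/forall_inP => J NJ; apply/implyP => JI; apply/eqP/minI.
Qed.

Lemma AwP I : reflect
  (I \in NS Lam /\ forall J, J \in NS Lam -> J \subset I -> J \in Bw w Lam)
  (I \in Aw w Lam).
Proof.
rewrite [_ \in Aw _ _]finset.in_set; apply: (iffP andP) => -[NI BI]; split=> //.
  by move=> J NJ; apply/implyP/(forall_inP BI).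
by apply/forall_inP => J NJ; apply/implyP; apply: BI.
Qed.

Lemma MwP I : reflect (I \in MinNS Lam /\ I \in Bw w Lam) (I \in Mw w Lam).
Proof. by rewrite [_ \in Mw _ _]finset.in_setI; apply: andP. Qed.

Lemma MinNS_diff_nonempty I J : I \in MinNS Lam -> J \in NS Lam -> J != I ->
  (J :\: I)%SET != finset.set0.
Proof.
move=> /MinNSP[_ minI] NJ; apply: contraNneq => e; apply/eqP/minI => //.
by rewrite -finset.setD_eq0 e.
Qed.

(** Below a minimal negative support there is no other one. *)
Lemma Mw_sub_Aw I : I \in Mw w Lam -> I \in Aw w Lam.
Proof.
move=> /MwP[/MinNSP[NI minI] BI]; apply/AwP; split=> // J NJ JI.
by rewrite (minI J NJ JI).
Qed.

Lemma Aw_Mw_nonempty I : I \in Aw w Lam -> Mw w Lam != finset.set0.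
Proof.
move=> /AwP[NI BI].
have [J /minsetP[NJ minJ] JI] :=
  @minset_exists _ (fun J => J \in NS Lam) I NI.
apply/finset.set0Pn; exists J; apply/MwP; split; last exact: BI.
by apply/MinNSP.
Qed.

Lemma lattice_mulmx g : Lam g -> map_mx intr A *m g = beta.
Proof.
case: hL => lam [Alam ->] [u Lu <-].
by rewrite mulmxDr Alam -map_mxM Lu map_mx0 addr0.
Qed.

End MinimalSupports.

Section CoefficientFamilies.
Variables (R : realType) (d n : nat) (A : 'M[int]_(d, n)).
Local Notation C := R[i].
Variables (w : 'cV[R]_n) (Lam : set 'cV[C]_n).
Implicit Types (I J : {set 'I_n}).

Lemma partial_prod_coeff0 J : J != finset.set0 -> (partial_prod R J)@_0 = 0.
Proof.
case/finset.set0Pn => j jJ; rewrite mcoeff0_prod (bigD1 j) //= mcoeffX mnm1_eq0.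
by rewrite mul0r.
Qed.

Lemma Apartial_coeff0 i : (Apartial R A i)@_0 = 0.
Proof.
rewrite /Apartial raddf_sum big1 // => j _ /=.
by rewrite mcoeffZ mcoeffX mnm1_eq0 mulr0.
Qed.

Lemma eps_famE I (K : NSidx Lam) : eps_fam Lam I K = ((val K == I)%:R)%:MP.
Proof. by rewrite ffunE; case: eqP; rewrite ?mpolyC1 ?mpolyC0. Qed.

(** By minimality [J] is not contained in [I] for [J <> I], so the glueing relation
    between them differentiates the constant 1 at least once. *)
Lemma eps_fam_Coeff_dir I : I \in Mw w Lam -> Coeff_dir A w (eps_fam Lam I).
Proof.
move=> MI; have /MwP[minI BI] := MI.
have glue (K J : NSidx Lam) : val K = I ->
    dact (partial_prod R (val J :\: val K)) (eps_fam Lam I K) =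
    dact (partial_prod R (val K :\: val J)) (eps_fam Lam I J).
  move=> KI; have [JI|JI] := eqVneq (val J) I.
    by rewrite (val_inj (etrans KI (esym JI)) : K = J).
  rewrite !eps_famE (negPf JI) mpolyC0 raddf0 dact_const KI.
  rewrite partial_prod_coeff0 ?mul0r ?mpolyC0 //.
  exact: MinNS_diff_nonempty minI (valP J) JI.
split=> [K i|K J|K].
- by rewrite eps_famE dact_const Apartial_coeff0 mul0r mpolyC0.
- have [KI|KI] := eqVneq (val K) I; first exact: glue.
  have [JI|JI] := eqVneq (val J) I; first exact/esym/glue.
  by rewrite !eps_famE (negPf KI) (negPf JI) mpolyC0 !raddf0.
rewrite eps_famE; case: eqP => [->|_ _]; last exact: mpolyC0.
by rewrite Mw_sub_Aw.
Qed.

(** The constant term of the [K]-component is the pairing of the free module with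
    the family supported at [I]; it factors through the module. *)
Lemma lin_span_Mdir_rel_coeff0 I (K : NSidx Lam) (f : free_mod Lam) :
  I \in Mw w Lam -> val K = I -> lin_span (@Mdir_rel R d n A w Lam) f -> (f K)@_0 = 0.
Proof.
move=> MI KI [k [a [r [relr ->]]]].
have /MwP[minI _] := MI.
rewrite sum_ffunE raddf_sum big1 // => l _ /=; rewrite ffunE.
rewrite -[LHS]/((a l * r l K)@_0) rmorphM /=.
suff -> : (r l K : {mpoly C[n]})@_0 = 0 by rewrite mulr0.
have gen0 (J : NSidx Lam) (P : {mpoly C[n]}) : P@_0 = 0 -> (P * (K == J)%:R)@_0 = 0.
  by move=> P0; rewrite rmorphM /= P0 mul0r.
case: (relr l) => [i J|J1 J2|J JA].
- by rewrite ffunE ffunE; apply: gen0; apply: Apartial_coeff0.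
- have [->|J12] := eqVneq J1 J2; first by rewrite subrr ffunE; exact: mcoeff0.
  have off (J J' : NSidx Lam) : J != J' ->
      (partial_prod R (val J' :\: val J)%SET * (K == J)%:R)@_0 = 0.
    move=> JJ'; have [e|_] := eqVneq K J; last by rewrite mulr0 mcoeff0.
    rewrite mulr1; apply: partial_prod_coeff0; rewrite -e KI.
    apply: (MinNS_diff_nonempty minI (valP J')); rewrite -KI.
    by rewrite val_eqE e eq_sym.
  rewrite !ffunE; apply: etrans (mcoeffB _ _ _) _.
  by apply: etrans (congr2 (fun x y => x - y) (off _ _ J12) (off J2 J1 _)) _;
    rewrite 1?eq_sym // subrr.
rewrite ffunE; case: eqP => [e|_]; last exact: mcoeff0.
by move: JA; rewrite -e KI Mw_sub_Aw.
Qed.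

Lemma quot_mod_pi_eq0 (S : pzRingType) (V : lmodType S) (G : set V) v :
  quot_mod_pi G v = 0 <-> lin_span G v.
Proof.
have pi0 : quot_mod_pi G 0 = 0.
  by have := quot_mod_piD G 0 0; rewrite addr0 -[LHS]addr0 => /addrI.
by rewrite -pi0; split=> [/quot_mod_piP|sv]; last apply/quot_mod_piP;
  rewrite subr0; [move/asboolP|apply/asboolP].
Qed.

Lemma Mdir_nonzero I : I \in Mw w Lam -> exists m : Mdir A w Lam, m <> 0.
Proof.
move=> MI; have /MwP[/MinNSP[NI _] _] := MI.
pose K : NSidx Lam := exist _ I NI.
exists (quot_mod_pi (@Mdir_rel R d n A w Lam) (free_gen K)).
move=> /quot_mod_pi_eq0/(lin_span_Mdir_rel_coeff0 MI (erefl : val K = I)).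
by rewrite ffunE eqxx mcoeff1 eqxx => /eqP; rewrite oner_eq0.
Qed.

(** If [Mw w Lam] is empty then so is [Aw w Lam], and every generator is killed. *)
Lemma Mdir_nonzero_Mw : (exists m : Mdir A w Lam, m <> 0) -> Mw w Lam != finset.set0.
Proof.
move=> [m m0]; apply: contra_notN m0 => Mw0.
have noA I : I \notin Aw w Lam.
  by apply: contraTN Mw0; apply: Aw_Mw_nonempty.
rewrite -[m]quot_mod_repr; apply/quot_mod_pi_eq0; set f : free_mod Lam := repr _.
have -> : f = \sum_K f K *: free_gen K.
  apply/ffunP => J; rewrite sum_ffunE (bigD1 J) //= big1 => [|K KJ].
    by rewrite addr0 !ffunE eqxx; exact: esym (mulr1 _).
  by rewrite !ffunE eq_sym (negPf KJ); exact: mulr0.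
elim/big_ind : _ => [|x y|K _]; first exact: lin_span0.
  exact: lin_spanD.
apply: lin_spanZ; exists 1%N, (fun=> 1), (fun=> free_gen K).
by split; [move=> _; apply: Mdir_rel_kill | rewrite big_ord1 scale1r].
Qed.

Lemma Coeff_dir_nonzero_Mw (c : coeff_fam Lam) : Coeff_dir A w c -> c <> 0 ->
  Mw w Lam != finset.set0.
Proof.
move=> [_ _ kill] c0; have [K /eqP cK] : exists K, c K != 0.
  apply: contrapT => /forallNP z; apply: c0; apply/ffunP => K.
  by rewrite ffunE; apply/eqP/negPn/negP; exact: z.
by apply: (@Aw_Mw_nonempty _ _ _ _ (val K)); apply/negPn/negP => /kill.
Qed.

End CoefficientFamilies.

(** * The special series and the equivalences *)

Section SpecialSeries.
Variables (R : realType) (d n : nat) (A : 'M[int]_(d, n)).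
Local Notation C := R[i].
Variables (beta : 'cV[C]_d) (w : 'cV[R]_n) (Lam : set 'cV[C]_n).
Hypothesis hL : exponent_lattice A beta Lam.
Variable lam : 'cV[C]_n.
Hypothesis Lam_lam : Lam lam.
Implicit Types (g : 'cV[C]_n) (u v : 'cV[int]_n) (I J : {set 'I_n}) (p : 'X_{1..n}).

Lemma sub_nsupp_addl g p : nsupp (g + mnm_vec R p) \subset nsupp g.
Proof.
apply/fintype.subsetP => j /nsupp_intP[z z0 e].
rewrite (in_nsupp_int (z := z - (p j)%:Z)); last first.
  by rewrite rmorphB /= -e !mxE addrK.
by rewrite subr_lt0 (lt_le_trans z0).
Qed.

Lemma phi_series_out (c : coeff_fam Lam) g : ~ Lam g -> phi_series lam c g = 0.
Proof. by move=> nL; rewrite /phi_series; case: asboolP. Qed.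

(** Both constants in the definition of the coefficient telescope to the same
    exponent, the componentwise minimum of [lam] and [lam + u]. *)
Lemma phi_series_epsE I (H : 'cV[int]_n -> C) :
  (forall u, H u != 0) ->
  (forall u p, reg_falling (lam + map_mx intr u) p * H (u - \col_j (p j)%:Z) = H u) ->
  forall u, ker_int A u ->
  phi_series lam (eps_fam Lam I) (lam + map_mx intr u) =
  ((nsupp (lam + map_mx intr u) == I)%:R * (H 0 / H u))%:MP.
Proof.
move=> H0 tele u Lu; set g := lam + _.
have Lg : Lam g by apply: (exponent_lattice_shift hL).
have glam : g - lam = map_mx intr u by rewrite /g addrC addKr.
have lamg : lam - g = map_mx intr (- u) by rewrite -opprB glam map_mxN.
rewrite /phi_series; case: asboolP => // _.
rewrite (insubT (fun J => J \in NS Lam) (NS_nsupp Lg)) /= eps_famE /= dact_const.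
apply: dact_inv_eq; first by rewrite (rtransit_coeff0 hL Lg Lam_lam glam) reg_falling_neq0.
rewrite dact_const (rtransit_coeff0 hL Lg Lam_lam glam).
rewrite (rtransit_coeff0 hL Lam_lam Lg lamg); congr (_%:MP).
have col : u - \col_j (pos_part u j)%:Z = 0 - \col_j (pos_part (- u) j)%:Z.
  by apply/matrixP => j k; rewrite !mxE (ord1 k) pos_partB sub0r.
have := tele u (pos_part u); rewrite col.
have := tele 0 (pos_part (- u)); rewrite map_mx0 addr0.
move=> <- <-; rewrite mulrCA [RHS]mulrC; congr (_ * _).
by rewrite -mulf_div divff // mulr1 mulrCA divff ?reg_falling_neq0 // mulr1.
Qed.

Variable I : {set 'I_n}.
Hypothesis MI : I \in Mw w Lam.
Local Notation phi := (phi_series lam (eps_fam Lam I)).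

Lemma phi_series_eps_supp : supp phi = stratum Lam I.
Proof.
have [H H0 tele] := reg_falling_telescope lam.
apply/seteqP; split => g; rewrite /supp /stratum /=.
  have [Lg|nLg] := pselect (Lam g); last by rewrite phi_series_out // eqxx.
  have [u Lu e] := exponent_latticeB hL Lam_lam Lg.
  have -> : g = lam + map_mx intr u by rewrite -e subrKC.
  rewrite (phi_series_epsE I H0 tele Lu) -e subrKC.
  by case: (eqVneq (nsupp g) I) => // _; rewrite mul0r mpolyC0 eqxx.
case=> Lg gI; have [u Lu e] := exponent_latticeB hL Lam_lam Lg.
have eg : g = lam + map_mx intr u by rewrite -e subrKC.
rewrite eg (phi_series_epsE I H0 tele Lu) -eg gI eqxx mul1r mpolyC_eq0.
by rewrite mulf_neq0 ?invr_eq0.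
Qed.

(** Since [u - p] is the translation from [lam] to [g], the value depends on [g]
    alone, hence is the same for both terms of a binomial. *)
Lemma phi_series_eps_transit (H : 'cV[int]_n -> C) :
  (forall u, H u != 0) ->
  (forall u p, reg_falling (lam + map_mx intr u) p * H (u - \col_j (p j)%:Z) = H u) ->
  forall g p u, ker_int A u -> g + mnm_vec R p = lam + map_mx intr u ->
  dact (falling_op (g + mnm_vec R p) p) (phi (g + mnm_vec R p)) =
  ((nsupp g \subset I)%:R * (H 0 / H (u - \col_j (p j)%:Z)))%:MP.
Proof.
move=> H0 tele g p u Lu e; have /MwP[/MinNSP[_ minI] _] := MI.
have Lg : Lam (g + mnm_vec R p) by rewrite e; apply: (exponent_lattice_shift hL).
rewrite [phi _](_ : _ = ((nsupp (g + mnm_vec R p) == I)%:R * (H 0 / H u))%:MP); last first.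
  by rewrite e (phi_series_epsE I H0 tele Lu).
rewrite dact_const; congr (_%:MP).
have [gI|ngI] := boolP (nsupp g \subset I).
  have nI : nsupp (g + mnm_vec R p) = I.
    by apply: minI (NS_nsupp Lg) (fintype.subset_trans (sub_nsupp_addl g p) gI).
  rewrite nI eqxx !mul1r falling_op_coeff0_reg ?addrK ?nI //.
  rewrite e mulrCA; congr (_ * _); rewrite -[in LHS](tele u p).
  by rewrite invfM mulrA divff ?reg_falling_neq0 // mul1r.
have [nI|_] := eqVneq (nsupp (g + mnm_vec R p)) I; last by rewrite !mul0r mulr0.
by rewrite falling_op_coeff0_eq0 ?addrK ?nI // !mul0r.
Qed.

Lemma phi_series_eps_const g : exists2 c : C, phi g = c%:MP & Lam g \/ c = 0.
Proof.
have [Lg|nLg] := pselect (Lam g); last first.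
  by exists 0; [rewrite phi_series_out // mpolyC0 | right].
have [H H0 tele] := reg_falling_telescope lam.
have [u Lu e] := exponent_latticeB hL Lam_lam Lg.
have -> : g = lam + map_mx intr u by rewrite -e subrKC.
rewrite (phi_series_epsE I H0 tele Lu); eexists; first by [].
by left; rewrite -e subrKC.
Qed.

Lemma phi_series_eps_Sol_dir : Sol_dir A beta w Lam phi.
Proof.
have subL : supp phi `<=` Lam by rewrite phi_series_eps_supp => g [].
split=> //.
- move=> g /subL Lg; exists g => //; exists 0 => //.
  by rewrite map_mx0 addr0.
- apply: hyp_ideal_act_eq0 => [p q u Lu pq g|i g].
    have pqv : g + mnm_vec R p = g + mnm_vec R q + map_mx intr u.
      rewrite -addrA; congr (_ + _); apply/matrixP => j k.
      by rewrite !mxE (ord1 k) -pq rmorphB /= addrC subrK.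
    have [Lg|nLg] := pselect (Lam (g + mnm_vec R q)); last first.
      rewrite !phi_series_out ?raddf0 // pqv => Lg; apply: nLg.
      rewrite -[g + _](addrK (map_mx intr u)) -map_mxN.
      by apply: (exponent_lattice_shift hL Lg); rewrite /ker_int /= mulmxN Lu oppr0.
    have [H H0 tele] := reg_falling_telescope lam.
    have [v Lv e] := exponent_latticeB hL Lam_lam Lg.
    have eq_v : g + mnm_vec R q = lam + map_mx intr v by rewrite -e subrKC.
    have Luv : ker_int A (v + u) by rewrite /ker_int /= mulmxDr Lv Lu addr0.
    rewrite (phi_series_eps_transit H0 tele Lv eq_v).
    rewrite (phi_series_eps_transit H0 tele Luv); last first.
      by rewrite pqv eq_v map_mxD addrA.
    have -> // : v + u - \col_j (p j)%:Z = v - \col_j (q j)%:Z.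
    apply/matrixP => j k; rewrite !mxE (ord1 k) -pq.
    by rewrite -addrA; congr (_ + _); rewrite addrAC subrr sub0r.
  have [c -> Lc] := phi_series_eps_const g.
  have [Lg|->] := Lc; last first.
    rewrite mpolyC0 scaler0 big1 // => j _.
    by rewrite scaler0 mderiv0 addr0 scaler0.
  rewrite -(lattice_mulmx hL Lg) mxE scaler_suml; apply: eq_bigr => j _.
  by rewrite mderivC addr0 scalerA mxE.
right; have /MwP[_ BI] := MI.
by rewrite phi_series_eps_supp; apply: (stratum_has_wmin hL).
Qed.

End SpecialSeries.

Section SolutionsForceBoundedStrata.
Variables (R : realType) (d n : nat) (A : 'M[int]_(d, n)).
Local Notation C := R[i].
Variables (beta : 'cV[C]_d) (w : 'cV[R]_n) (Lam : set 'cV[C]_n).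
Hypothesis hL : exponent_lattice A beta Lam.

(** The transit from [g] to [g'] creates no new negative integer entry, so its
    operator has a nonzero constant term and is injective. *)
Lemma Sol_dir_supp_closed phi g g' : Sol_dir A beta w Lam phi ->
  phi g != 0 -> Lam g' -> nsupp g' \subset nsupp g -> phi g' != 0.
Proof.
move=> sol phig Lg' /fintype.subsetP sub; have [_ sL _ _] := sol.
have [u Lu e] := exponent_latticeB hL Lg' (sL g phig).
have := Sol_dir_transit sol Lu e; apply: contra_eq_neq => ->; rewrite raddf0.
apply: dact_neq0 phig; rewrite falling_op_coeff0_reg ?reg_falling_neq0 //.
apply/fintype.subsetP => j.
have [p0|p0] := posnP (pos_part u j).
  case: (boolP (j \in nsupp g)) => // ng.
  move=> /nsupp_intP[z z0]; rewrite !mxE p0 subr0 => gz.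
  by move: ng; rewrite (in_nsupp_int gz) z0.
move=> /nsupp_intP[z z0 gz]; apply: sub; rewrite (in_nsupp_int (z := z)) //.
rewrite -gz -[g](subrK g') e !mxE addrAC -[(pos_part u j)%:R]/((pos_part u j)%:Z%:~R).
rewrite -rmorphB /= pos_partB; suff -> : pos_part (- u) j = 0%N by rewrite oppr0 add0r.
apply/eqP; rewrite -eqz_nat pos_partE mxE max_r // oppr_le0.
by move: p0; rewrite -ltz_nat pos_partE lt_max ltxx orbF => /ltW.
Qed.

Lemma Sol_dir_nonzero_Mw phi : Sol_dir A beta w Lam phi -> phi <> 0 ->
  Mw w Lam != finset.set0.
Proof.
move=> sol phi0; have [_ sL _ [//|[v [phiv vmin]]]] := sol.
apply: (@Aw_Mw_nonempty _ _ _ _ (nsupp v)); apply/AwP.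
split=> [|J NJ Jv]; first exact/NS_nsupp/sL.
rewrite [_ \in _]finset.in_set NJ; apply/asboolP; exists v; first exact: sL.
exists 0 => _ [g [Lg gJ] <-]; apply: vmin.
by apply: (Sol_dir_supp_closed sol phiv Lg); rewrite gJ.
Qed.

End SolutionsForceBoundedStrata.

Theorem theorem3p7 (R : realType) (d n : nat) (A : 'M[int]_(d, n))
    (rankA : \rank (map_mx intr A : 'M[rat]_(d, n)) = d)
    (beta : 'cV[R[i]]_d) (w : 'cV[R]_n) (wgen : L_generic A w)
    (Lam : set 'cV[R[i]]_n) (Lam_lattice : exponent_lattice A beta Lam)
    (lam : 'cV[R[i]]_n) (Lam_lam : Lam lam) :
  (forall I : {set 'I_n}, I \in Mw w Lam ->
     let phi := phi_series lam (eps_fam Lam I) in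
     [/\ Coeff_dir A w (eps_fam Lam I),
         Sol_dir A beta w Lam phi,
         supp phi = stratum Lam I &
         lexp w phi = vmin w Lam I]) /\
  [<-> Mw w Lam != finset.set0;
       exists m : Mdir A w Lam, m <> 0;
       exists2 c : coeff_fam Lam, Coeff_dir A w c & c <> 0;
       exists2 phi : logseries R n, Sol_dir A beta w Lam phi & phi <> 0].
Proof.
have eps I : I \in Mw w Lam -> let phi := phi_series lam (eps_fam Lam I) in
    [/\ Coeff_dir A w (eps_fam Lam I), Sol_dir A beta w Lam phi,
        supp phi = stratum Lam I & lexp w phi = vmin w Lam I].
  move=> MI phi; have sE := phi_series_eps_supp Lam_lattice Lam_lam I.
  split=> //; first exact: eps_fam_Coeff_dir.
    exact: (phi_series_eps_Sol_dir Lam_lattice Lam_lam MI).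
  by rewrite /lexp sE.
split=> //; tfae.
- by case/finset.set0Pn => I; apply: Mdir_nonzero.
- move=> /Mdir_nonzero_Mw/finset.set0Pn[I MI]; have [cI _ _ _] := eps I MI.
  exists (eps_fam Lam I) => // e0.
  have /MwP[/MinNSP[NI _] _] := MI.
  have := congr1 (fun c : coeff_fam Lam => c (exist _ I NI)) e0.
  by rewrite eps_famE ffunE /= eqxx mpolyC1 => /eqP; rewrite oner_eq0.
- case=> c cc c0; have /finset.set0Pn[I MI] := Coeff_dir_nonzero_Mw cc c0.
  have [_ solI sI _] := eps I MI; exists (phi_series lam (eps_fam Lam I)) => // e0.
  have /MwP[/MinNSP[/NSP[g Sg] _] _] := MI.
  by move: Sg; rewrite -sI e0 /supp /= eqxx.
- by case=> phi sol phi0; apply: (Sol_dir_nonzero_Mw Lam_lattice sol phi0).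
Qed.
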